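(* Let $n\geq 3$ be an integer. If $n$ is odd, then \[ \mathrm{Ind}(E_{2n+2}) \simeq \begin{cases} S^{2k+1} \vee S^{2k+1} \vee S^{2k+1} & \text{if } n=4k+1, \\ S^{2k+2} & \text{if } n=4k+3. \end{cases}\] If $n$ is even, then \[ \mathrm{Ind}(E_{2n+2}) \simeq \begin{cases} S^{2k} & \text{if } n=6k, \\ S^{2k+1}\vee S^{2k+1} & \text{if } n=6k+2, \\ S^{2k+2} & \text{if } n=6k+4. \end{cases}\]
   Context: For a graph $G$, the independence complex $\mathrm{Ind}(G)$ is the simplicial complex whose vertices are the vertices of $G$ and whose faces are the independent sets of $G$. Let $n\ge 2$; all vertex indices below are taken modulo $2n+2$. Let $K_{n+1,n+1}$ be the complete bipartite graph on vertex set $\{1,2,\ldots,2n+2\}$ with bipartition into odd and even numbers. Let $DC_{2n+2}$ be the graph on vertex set $\{c_1,\ldots,c_{2n+2}\}$ with edges $\{c_i,c_{i+1}\}$ for $i\in[2n+2]$ and $\{c_i,c_{i+n+1}\}$ for $i\in[n+1]$ (a $(2n+2)$-cycle with antipodal chords). Let $C_{n+1}$ be the cycle on vertex set $\{c_1,c_3,\ldots,c_{2n+1}\}$ with edges $\{c_i,c_{i+2}\}$ for odd $i$. The graph $E_{2n+2}$ is defined as follows: if $n$ is odd, take disjoint copies of $K_{n+1,n+1}$ and $DC_{2n+2}$ and add an edge joining each vertex $i$ of $K_{n+1,n+1}$ to $c_i$; if $n$ is even, take disjoint copies of $K_{n+1,n+1}$ and $C_{n+1}$ and add edges joining each vertex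 $c_i$ of $C_{n+1}$ to the vertices $i$ and $i+n+1$ of $K_{n+1,n+1}$. $\simeq$ denotes homotopy equivalence and $\vee$ wedge sum. *)

(* Defs.v *)
From mathcomp Require Import all_boot all_order all_algebra.
From mathcomp Require Import all_classical reals topology normedtype homotopy.
Set Implicit Arguments.
Unset Strict Implicit.
Unset Printing Implicit Defensive.
Import Order.TTheory GRing.Theory Num.Theory.
Import numFieldNormedType.Exports.
Local Open Scope classical_set_scope.
Local Open Scope ring_scope.

Record sgraph := SGraph {
  vertex :> finType;
  adj : rel vertex;
  adj_sym : symmetric adj;
  adj_irrefl : irreflexive adj }.

(* [r] lists each edge in at least one orientation; a pair [r x x] is dropped. *)
Section GraphOf.
Context (V : finType) (r : rel V).

Definition edge_of : rel V := fun x y => (x != y) && (r x y || r y x).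

Lemma edge_of_sym : symmetric edge_of.
Proof. by move=> x y; rewrite /edge_of eq_sym orbC. Qed.

Lemma edge_of_irrefl : irreflexive edge_of.
Proof. by move=> x; rewrite /edge_of eqxx. Qed.

Definition graph_of := SGraph edge_of_sym edge_of_irrefl.
End GraphOf.

Definition glued_rel (G H : sgraph) (r : G -> H -> bool) : rel (G + H)%type :=
  fun u v => match u, v with
             | inl x, inl y => adj x y
             | inr x, inr y => adj x y
             | inl x, inr y => r x y
             | inr _, inl _ => false
             end.

(* The disjoint union of G and H with the additional edges {x, y}, r x y. *)
Definition glue (G H : sgraph) (r : G -> H -> bool) : sgraph :=
  graph_of (glued_rel r).

(* The vertex index i in {1, ..., 2n+2} is encoded by its residue modulo
   2n+2, so 2n+2 becomes 0; the modulus being even, parity is preserved.      *)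
Notation index n := 'Z_(n.*2.+2).

Definition Knn (n : nat) : sgraph :=
  graph_of (fun i j : index n => odd i && ~~ odd j).

(* The chords {c_i, c_(i+n+1)} for i in [n+1] are those for all i, since
   (i + n + 1) + n + 1 = i modulo 2n+2.                                       *)
Definition DC (n : nat) : sgraph :=
  graph_of (fun i j : index n => (j == i + 1) || (j == i + n.+1%:R)).

Definition Codd (n : nat) : sgraph :=
  graph_of (fun i j : {i : index n | odd i} => val j == val i + 2%:R).

Definition E (n : nat) : sgraph :=
  if odd n then
    glue (fun (i : Knn n) (c : DC n) => i == c :> index n)
  else
    glue (fun (i : Knn n) (c : Codd n) =>
      (i == val c :> index n) || (i == val c + n.+1%:R :> index n)).

Record scomplex (V : finType) := SComplex {
  faces : {set {set V}};
  faces_vertex : forall v, [set v]%SET \in faces;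
  faces_sub : forall s t : {set V}, s \in faces -> t \subset s -> t \in faces }.

Section IndependenceComplex.
Context (G : sgraph).

Definition independent (s : {set G}) : bool :=
  [forall x in s, forall y in s, ~~ adj x y].

Lemma independent1 v : [set v]%SET \in [set s | independent s]%SET.
Proof.
rewrite inE; apply/forall_inP => x /set1P ->.
by apply/forall_inP => y /set1P ->; rewrite adj_irrefl.
Qed.

Lemma independent_sub (s t : {set G}) :
  s \in [set s | independent s]%SET -> t \subset s ->
  t \in [set s | independent s]%SET.
Proof.
rewrite !inE => /forall_inP si /fintype.subsetP ts; apply/forall_inP => x /ts xs.
by apply/forall_inP => y /ts; move/forall_inP: (si x xs); apply.
Qed.

Definition Ind : scomplex G := SComplex independent1 independent_sub.
End IndependenceComplex.

Section Spaces.
Context (R : realType).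

(* Barycentric coordinates, with the topology induced by the product R^V; as V
   is finite this is the weak topology of the complex.                        *)
Definition realization_set (V : finType) (K : scomplex V) :=
  [set x : {ptws V -> R} |
    [/\ forall v, 0 <= x v, \sum_v x v = 1
      & [set v | x v != 0]%SET \in faces K]].

Definition realization (V : finType) (K : scomplex V) : topologicalType :=
  set_type (realization_set K).

Definition sphere_set (d : nat) :=
  [set x : 'rV[R]_d.+1 | \sum_i x ord0 i ^+ 2 = 1].
Arguments sphere_set : clear implicits.

Definition sphere (d : nat) : topologicalType := set_type (sphere_set d).

Lemma sphere_pole (d : nat) :
  (delta_mx ord0 ord0 : 'rV[R]_d.+1) \in sphere_set d.
Proof.
rewrite inE /sphere_set /= (bigD1 ord0) //= big1 => [|i /negbTE i0].
  by rewrite mxE !eqxx expr1n addr0.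
by rewrite mxE eqxx i0 expr0n.
Qed.

Definition pole (d : nat) : sphere d :=
  exist (fun x => x \in sphere_set d) (delta_mx ord0 ord0) (sphere_pole d).

Definition wedge_spheres (m d : nat) : topologicalType :=
  wedge (fun _ : 'I_m => pole d).

Definition homotopic (X Y : topologicalType) (f g : X -> Y) : Prop :=
  exists H : X * R -> Y,
    [/\ {within [set: X] `*` `[0, 1], continuous H},
        forall x, H (x, 0) = f x
      & forall x, H (x, 1) = g x].

Definition homotopy_equivalent (X Y : topologicalType) : Prop :=
  exists (f : X -> Y) (g : Y -> X),
    [/\ continuous f, continuous g,
        homotopic (g \o f) idfun & homotopic (f \o g) idfun].
End Spaces.

(* Main.v *)
(** The faces of Ind(E) meet one side of K_(n+1,n+1) only, which exhibits Ind(E)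
    as a suspension of Ind(DC), resp. Ind(C_(n+1)); a cycle loses three vertices
    at the cost of one more suspension, and a (possibly twisted) ladder loses two
    columns, and changes its twist, at the cost of one more suspension.

    A suspension is a disjoint edge of the graph, so all this happens among
    independence complexes. Only one move is needed: if every neighbour of w is a
    neighbour of u or of v, then the edge uv may be added or deleted (and, for
    u = v, the vertex u may be deleted), since pushing the weight min(x_u, x_v)
    towards w retracts one realization onto the other by a straight-line homotopy.
    The moves end with the disjoint union of a complete graph K_(r+1) and d edges,
    whose independence complex, the join of r + 1 points and S^(d-1), is mapped
    explicitly to the wedge of r copies of S^d: the cone on one of the points is
    sent to the base point. *)
Require Import Defs.
From mathcomp Require Import all_boot all_order all_algebra.
From mathcomp Require Import all_classical reals topology normedtype homotopy.
From mathcomp Require Import realfun.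
From mathcomp Require Import ring lra zify.
Set Implicit Arguments.
Unset Strict Implicit.
Unset Printing Implicit Defensive.
Import Order.TTheory GRing.Theory Num.Theory.
Import numFieldNormedType.Exports.
Local Open Scope classical_set_scope.
Local Open Scope ring_scope.

(** * Homotopy equivalence *)

(** The case distinction records where the reductions stop. For even n the (n+1)-cycle loses
    vertices by threes until its length is 2, 3 or 4: an edge, a triangle, or a 4-cycle, which folds
    to an edge. For odd n, $DC_{2n+2}$ is a Möbius ladder whose n+1 columns are the antipodal
    chords; it shrinks to two columns in (n-1)/2 steps, whose parity decides whether a twist
    remains. Two twisted columns form $K_4$, two untwisted ones a 4-cycle. The graphs $K_2$, $K_3$,
    $K_4$ yield 1, 2, 3 spheres; t steps leave t isolated edges, the suspension adds one, and the
    dimension is t+1.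

    All graphs met during a reduction live on one fixed finite type: a deleted vertex is one not
    related to itself, and the isolated edges produced by the steps are kept on vertices freed by
    them. In the comparison of the join with the wedge, the vertex carrying weight cannot be chosen
    continuously, so the maps are written symmetrically in all of them, through sums and positive
    parts. *)

Section Continuity.
Context {R : realType}.
Implicit Types X : topologicalType.

Lemma continuous_cstR X (c : R) : continuous (fun _ : X => c).
Proof. by move=> x; exact: cvg_cst. Qed.

Lemma continuous_addR X (f g : X -> R) :
  continuous f -> continuous g -> continuous (fun x => f x + g x).
Proof. by move=> cf cg x; apply: cvgD; [exact: cf|exact: cg]. Qed.

Lemma continuous_oppR X (f : X -> R) :
  continuous f -> continuous (fun x => - f x).
Proof. by move=> cf x; apply: cvgN; exact: cf. Qed.

Lemma continuous_mulR X (f g : X -> R) :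
  continuous f -> continuous g -> continuous (fun x => f x * g x).
Proof. by move=> cf cg x; apply: cvgM; [exact: cf|exact: cg]. Qed.

Lemma continuous_invR X (f : X -> R) :
  (forall x, f x != 0) -> continuous f -> continuous (fun x => (f x)^-1).
Proof. by move=> f0 cf x; apply: cvgV => //; exact: cf. Qed.

Lemma continuous_normR X (f : X -> R) :
  continuous f -> continuous (fun x => `|f x|).
Proof. by move=> cf x; apply: cvg_norm; exact: cf. Qed.

Lemma continuous_minR X (f g : X -> R) :
  continuous f -> continuous g -> continuous (fun x => Num.min (f x) (g x)).
Proof. by move=> cf cg x; apply: continuous_min; [exact: cf|exact: cg]. Qed.

Lemma continuous_maxR X (f g : X -> R) :
  continuous f -> continuous g -> continuous (fun x => Num.max (f x) (g x)).
Proof. by move=> cf cg x; apply: continuous_max; [exact: cf|exact: cg]. Qed.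

Lemma continuous_sumR X (I : finType) (P : pred I) (f : I -> X -> R) :
  (forall i, continuous (f i)) -> continuous (fun x => \sum_(i | P i) f i x).
Proof.
move=> cf; apply: continuous_big => // -[x y].
by apply: cvgD; [exact: cvg_fst|exact: cvg_snd].
Qed.

Lemma continuous_ptws X (V : Type) (f : X -> {ptws V -> R}) :
  (forall v, continuous (fun x => f x v)) -> continuous f.
Proof.
move=> cf x; apply/cvg_sup => v U /= [/= _ [[W oW <-] Wv WU]].
apply: filterS WU _; apply: cf; exact: open_nbhs_nbhs.
Qed.

Lemma continuous_set_val (T : topologicalType) (A : set T) :
  continuous (val : set_type A -> T).
Proof. exact: initial_continuous. Qed.

Lemma continuous_coord X (V : eqType) (v : V) (f : X -> {ptws V -> R}) :
  continuous f -> continuous (fun x => f x v).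
Proof.
move=> cf x.
have pc := @proj_continuous V (fun=> R) v.
exact: (@continuous_comp X {ptws V -> R} R f (@proj V (fun=> R) v) x (cf x) (pc (f x))).
Qed.

End Continuity.

Section Homotopy.
Context {R : realType}.
Implicit Types X Y Z T : topologicalType.

Lemma continuous_pair X Y Z (f : X -> Y) (g : X -> Z) :
  continuous f -> continuous g -> continuous (fun x => (f x, g x)).
Proof. by move=> cf cg x; exact: (cvg_pair (cf x) (cg x)). Qed.

Lemma continuous_after X Y Z (g : Y -> Z) (f : X -> Y) :
  continuous g -> continuous f -> continuous (fun x => g (f x)).
Proof. by move=> cg cf x; apply: continuous_comp; [exact: cf|exact: cg]. Qed.

Lemma continuous_fst X Y : continuous (fst : X * Y -> X).
Proof. by move=> p; exact: cvg_fst. Qed.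

Lemma continuous_snd X Y : continuous (snd : X * Y -> Y).
Proof. by move=> p; exact: cvg_snd. Qed.

Lemma closed_ler X (f g : X -> R) :
  continuous f -> continuous g -> closed [set x | f x <= g x].
Proof.
move=> cf cg.
have -> : [set x | f x <= g x] = (fun x => f x - g x) @^-1` [set x | x <= 0].
  by apply/funext => x /=; rewrite subr_le0.
apply: preimage_closed; last exact: closed_le.
move=> x _; apply: continuous_addR => //; exact: continuous_oppR.
Qed.

Definition clamp (t : R) : R := Num.max 0 (Num.min t 1).

Lemma clamp_itv t : 0 <= clamp t <= 1.
Proof. by rewrite /clamp le_max lexx /= ge_max ler01 ge_min lexx orbT. Qed.

Lemma clamp_id t : 0 <= t <= 1 -> clamp t = t.
Proof. by case/andP=> t0 t1; rewrite /clamp min_l// max_r. Qed.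

Lemma clamp0 : clamp 0 = 0. Proof. by rewrite clamp_id ?lexx ?ler01. Qed.
Lemma clamp1 : clamp 1 = 1. Proof. by rewrite clamp_id ?lexx ?ler01. Qed.

Lemma continuous_clamp X (f : X -> R) :
  continuous f -> continuous (fun x => clamp (f x)).
Proof.
move=> cf; apply: continuous_maxR; first exact: continuous_cstR.
by apply: continuous_minR => //; exact: continuous_cstR.
Qed.

(** Homotopies over the whole time axis avoid the subspace topology on the strip over [0, 1];
    precomposing time with [clamp] shows that nothing is lost ([homotopicP]). *)
Definition chomotopic X Y (f g : X -> Y) : Prop :=
  exists H : X * R -> Y, [/\ continuous H, forall x, H (x, 0) = f x
    & forall x, H (x, 1) = g x].

Lemma continuous_within_comp X Y Z (A : set Y) (h : Y -> Z) (f : X -> Y) :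
  {within A, continuous h} -> continuous f -> (forall x, A (f x)) ->
  continuous (h \o f).
Proof.
move=> /subspace_continuousP ch cf Af x U /(ch _ (Af x)) hU.
have hx : nbhs x (f @^-1` [set y | A y -> (h @^-1` U) y]) := cf x _ hU.
by apply: filterS hx => y /=; apply; exact: Af.
Qed.

Lemma homotopicP X Y (f g : X -> Y) : homotopic R f g <-> chomotopic f g.
Proof.
split=> -[H [cH H0 H1]]; last first.
  by exists H; split=> //; exact: continuous_subspaceT.
exists (fun p => H (p.1, clamp p.2)); split.
- have cp : continuous (fun p : X * R => (p.1, clamp p.2)).
    apply: continuous_pair; first exact: continuous_fst.
    by apply: continuous_clamp; exact: continuous_snd.
  refine (continuous_within_comp cH cp _) => p.
  by split=> //=; rewrite in_itv /= clamp_itv.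
- by move=> x /=; rewrite clamp0.
- by move=> x /=; rewrite clamp1.
Qed.

Lemma chomotopic_refl X Y (f : X -> Y) : continuous f -> chomotopic f f.
Proof.
by move=> cf; exists (f \o fst); split=> //; apply: continuous_after => //;
  exact: continuous_fst.
Qed.

Lemma chomotopic_trans X Y (g f h : X -> Y) :
  chomotopic f g -> chomotopic g h -> chomotopic f h.
Proof.
move=> [H [cH H0 H1]] [K [cK K0 K1]].
pose A : set (X * R) := [set p | p.2 <= 2^-1].
pose B : set (X * R) := [set p | 2^-1 <= p.2].
pose L (p : X * R) := if p.2 <= 2^-1 then H (p.1, clamp (2 * p.2))
         else K (p.1, clamp (2 * p.2 - 1)).
have c2 : continuous (fun p : X * R => 2 * p.2).
  by apply: continuous_mulR; [exact: continuous_cstR|exact: continuous_snd].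
exists L; split; last 2 first.
- by move=> x; rewrite /L /= ifT ?mulr0 ?clamp0// invr_ge0.
- move=> x; rewrite /L /= ifF; last by apply/negbTE; rewrite -ltNge; lra.
  by rewrite (_ : 2 * 1 - 1 = 1) ?clamp1//; ring.
apply/continuous_subspace_setT.
have -> : [set: X * R] = A `|` B.
  by apply/esym; rewrite -subTset => p _; case: (leP p.2 2^-1) => [|/ltW]; [left|right].
apply: withinU_continuous.
- by apply: closed_ler; [exact: continuous_snd|exact: continuous_cstR].
- by apply: closed_ler; [exact: continuous_cstR|exact: continuous_snd].
- apply: (@subspace_eq_continuous _ A Y (fun p => H (p.1, clamp (2 * p.2))) L).
    by move=> p /set_mem /= Ap; rewrite /L ifT.
  have cL : continuous (fun p : X * R => H (p.1, clamp (2 * p.2))).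
    apply: (continuous_after cH).
    by apply: continuous_pair; [exact: continuous_fst|exact: continuous_clamp].
  exact: continuous_subspaceT cL.
- apply: (@subspace_eq_continuous _ B Y (fun p => K (p.1, clamp (2 * p.2 - 1))) L).
    move=> p /set_mem /= Bp; rewrite /L; case: ifPn => // Ap.
    have -> : p.2 = 2^-1 by apply/eqP; rewrite eq_le Ap.
    by rewrite divff ?pnatr_eq0// subrr clamp1 clamp0 H1 K0.
  have cL : continuous (fun p : X * R => K (p.1, clamp (2 * p.2 - 1))).
    apply: (continuous_after cK); apply: continuous_pair; first exact: continuous_fst.
    by apply: continuous_clamp; apply: continuous_addR => //; exact: continuous_cstR.
  exact: continuous_subspaceT cL.
Qed.

Lemma chomotopic_comp X Y Z T (k : Y -> Z) (f g : X -> Y) (l : T -> X) :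
  continuous k -> continuous l -> chomotopic f g ->
  chomotopic (k \o f \o l) (k \o g \o l).
Proof.
move=> ck cl [H [cH H0 H1]]; exists (fun p => k (H (l p.1, p.2))); split.
- apply: (continuous_after ck); apply: (continuous_after cH).
  apply: continuous_pair; last exact: continuous_snd.
  by apply: (continuous_after cl); exact: continuous_fst.
- by move=> x; rewrite H0.
- by move=> x; rewrite H1.
Qed.

Lemma homotopic_sym X Y (f g : X -> Y) : homotopic R f g -> homotopic R g f.
Proof.
move=> /homotopicP[H [cH H0 H1]]; apply/homotopicP.
exists (fun p => H (p.1, 1 - p.2)); split.
- apply: (continuous_after cH); apply: continuous_pair; first exact: continuous_fst.
  apply: continuous_addR; first exact: continuous_cstR.
  by apply: continuous_oppR; exact: continuous_snd.
- by move=> x; rewrite subr0 H1.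
- by move=> x; rewrite subrr H0.
Qed.

Lemma heq_sym X Y : homotopy_equivalent R X Y -> homotopy_equivalent R Y X.
Proof. by case=> f [g [cf cg fg gf]]; exists g, f. Qed.

Lemma heq_trans Y X Z :
  homotopy_equivalent R X Y -> homotopy_equivalent R Y Z ->
  homotopy_equivalent R X Z.
Proof.
move=> [f [g [cf cg /homotopicP gf /homotopicP fg]]].
move=> [k [l [ck cl /homotopicP lk /homotopicP kl]]].
exists (k \o f), (g \o l); split.
- exact: (continuous_after ck cf).
- exact: (continuous_after cg cl).
- apply/homotopicP/(chomotopic_trans _ gf).
  exact: (chomotopic_comp cg cf lk).
- apply/homotopicP/(chomotopic_trans _ kl).
  exact: (chomotopic_comp ck cl fg).
Qed.

Lemma heq_homeo X Y (f : X -> Y) (g : Y -> X) :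
  continuous f -> continuous g -> cancel f g -> cancel g f ->
  homotopy_equivalent R X Y.
Proof.
move=> cf cg fK gK; exists f, g; split=> //.
- rewrite (_ : g \o f = idfun); last by apply/funext => x /=; exact: fK.
  by apply/homotopicP/chomotopic_refl => x; exact: cvg_id.
- rewrite (_ : f \o g = idfun); last by apply/funext => x /=; exact: gK.
  by apply/homotopicP/chomotopic_refl => x; exact: cvg_id.
Qed.

Lemma heq_refl X : homotopy_equivalent R X X.
Proof. by apply: (@heq_homeo _ _ id id) => // x; exact: cvg_id. Qed.

Section Subsets.
Context (U V : Type) (A : set {ptws U -> R}) (B : set {ptws V -> R}).

Definition restr (f : {ptws U -> R} -> {ptws V -> R}) (fAB : forall x, A x -> B (f x)) :
  set_type A -> set_type B := fun x => SigSub (mem_set (fAB _ (set_valP x))).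

Lemma continuous_set_type X (f : X -> set_type B) :
  (forall v, continuous (fun x => val (f x) v)) -> continuous f.
Proof.
by move=> cf; apply: continuous_comp_initial; exact: continuous_ptws.
Qed.

(** The homotopies used later are formulas for vectors that are known to stay in [B] only at times
    in [0, 1]; hence the built-in clamp. *)
Lemma homotopic_set_type X (f g : X -> set_type B) (H : X -> R -> {ptws V -> R}) :
  (forall v, continuous (fun p : X * R => H p.1 (clamp p.2) v)) ->
  (forall x t, 0 <= t <= 1 -> B (H x t)) ->
  (forall x, H x 0 = val (f x)) -> (forall x, H x 1 = val (g x)) ->
  homotopic R f g.
Proof.
move=> cH BH H0 H1; apply/homotopicP.
exists (fun p => SigSub (mem_set (BH p.1 _ (clamp_itv p.2)))); split.
- exact: continuous_set_type.
- by move=> x; apply: val_inj => /=; rewrite clamp0 H0.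
- by move=> x; apply: val_inj => /=; rewrite clamp1 H1.
Qed.

End Subsets.
End Homotopy.

(** * Flag complexes *)

Section Flag.
Context {R : realType}.
Implicit Types V W : finType.

(** The last clause with u = v forces [r v v] on the support. The diagonal of [r] thus encodes the
    vertex set, and vertices can be deleted without changing the type [V]. *)
Definition flag_set V (r : rel V) : set {ptws V -> R} :=
  [set x | [/\ forall v, 0 <= x v, \sum_v x v = 1
    & forall u v, x u != 0 -> x v != 0 -> r u v]].

Definition flag V (r : rel V) : topologicalType := set_type (flag_set r).

Lemma eq_flag_set V (r s : rel V) :
  (forall u v, r u u -> r v v -> r u v = s u v) ->
  (forall u, s u u -> r u u) -> flag_set r = flag_set s.
Proof.
move=> rs sr; apply/funext => x; apply/propext; split=> -[x0 x1 xr];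
  split=> // u v xu xv.
  by rewrite -rs; exact: xr.
by rewrite rs; [exact: xr|apply: sr; exact: xr|apply: sr; exact: xr].
Qed.

Section Collapse.
Context (V : finType) (r : rel V) (u v w : V).
Hypotheses (r_sym : symmetric r) (wu : w != u) (wv : w != v) (rww : r w w).
Hypothesis cone : forall z, r z z -> r u z -> r v z -> r w z.

(** With [r] read as non-adjacency, passing to [s] adds the edge uv to the graph; for u = v it
    switches off [r u u] and so deletes u. *)
Let s : rel V := fun a b =>
  r a b && ~~ ((a == u) && (b == v) || (a == v) && (b == u)).
Let m (x : {ptws V -> R}) : R := Num.min (x u) (x v).
(** This is the indicator of the set {u, v}: when u = v the weight is taken away, and handed to w,
    only once. *)
Let b (z : V) : R := ((z == u) || (z == v))%:R.
Let rho (x : {ptws V -> R}) : {ptws V -> R} :=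
  fun z => x z - m x * b z + m x * (\sum_y b y) * (z == w)%:R.

Let m_ge0 x : flag_set r x -> 0 <= m x.
Proof. by case=> x0 _ _; rewrite /m le_min !x0. Qed.

Let rho_ge0 x z : flag_set r x -> 0 <= rho x z.
Proof.
move=> rx; have m0 := m_ge0 rx; have [x0 _ _] := rx.
apply: addr_ge0; last by rewrite !mulr_ge0 // sumr_ge0.
rewrite subr_ge0 /b; have [->|_] := eqVneq z u.
  by rewrite mulr1 /m ge_min lexx.
have [->|_] := eqVneq z v; first by rewrite mulr1 /m ge_min lexx orbT.
by rewrite mulr0.
Qed.

Let rho_sum x : flag_set r x -> \sum_z rho x z = 1.
Proof.
case=> _ x1 _; rewrite /rho big_split /= sumrB x1 -!mulr_sumr.
rewrite (_ : \sum_i (i == w)%:R = 1 :> R) ?mulr1 ?subrK//.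
by rewrite (bigD1 w) //= eqxx big1 ?addr0 // => i /negbTE ->.
Qed.

Let rho_supp x z : flag_set r x -> rho x z != 0 -> x z != 0 \/ z = w /\ m x != 0.
Proof.
move=> rx; have [z0|? _] := eqVneq (x z) 0; last by left.
have [zw|zw] := eqVneq z w.
  have [m0|? _] := eqVneq (m x) 0; last by right; rewrite zw.
  by rewrite /rho m0 !mul0r -zw z0 subr0 addr0 eqxx.
have := rho_ge0 z rx; rewrite /rho z0 (negbTE zw) mulr0 addr0 => h.
have : 0 <= m x * b z by rewrite mulr_ge0 ?m_ge0.
by move=> h' /eqP; case; lra.
Qed.

(** This keeps the straight-line homotopy inside the complex: the supports of x and [rho x] together
    span a face. If weight is moved at all, both u and v lie in the support of x, so each vertex of
    the support is related to both, and by [cone] to w. *)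
Let supp_rel x y z : flag_set r x -> (x y != 0 \/ y = w /\ m x != 0) ->
  (x z != 0 \/ z = w /\ m x != 0) -> r y z.
Proof.
move=> rx; have [x0 _ xr] := rx.
have key t : x t != 0 -> m x != 0 -> r w t.
  move=> xt mx; have := m_ge0 rx; rewrite le_eqVlt eq_sym (negbTE mx) /= /m lt_min.
  by case/andP=> ? ?; apply: cone; apply: xr => //; rewrite gt_eqF.
move=> [yx|[-> my]] [zx|[-> mz]]; [exact: xr| |exact: key|by []].
by rewrite r_sym; exact: key.
Qed.

Let rho_flag x : flag_set r x -> flag_set s (rho x).
Proof.
move=> rx; split=> [z||y z yx zx]; [exact: rho_ge0|exact: rho_sum|].
apply/andP; split; first by apply: (supp_rel rx); exact: rho_supp.
(* The smaller of the two weights has been removed completely, so u and v no longer occur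
   together. *)
have : (rho x u == 0) || (rho x v == 0).
  rewrite /rho /b !eqxx orbT !(eq_sym _ w) (negbTE wu) (negbTE wv) /= !mulr0 !addr0
    !mulr1.
  rewrite /m; case: (leP (x u) (x v)) => _; by rewrite subrr eqxx ?orbT.
apply: contraTN => /orP[] /andP[/eqP<- /eqP<-]; by rewrite negb_or yx zx.
Qed.

Lemma collapse : homotopy_equivalent R (flag r) (flag s).
Proof.
have sr x : flag_set s x -> flag_set r x.
  by case=> x0 x1 xs; split=> // y z yx zx; case/andP: (xs _ _ yx zx).
have crho (X : topologicalType) (f : X -> {ptws V -> R}) z :
    (forall z, continuous (fun x => f x z)) -> continuous (fun x => rho (f x) z).
  move=> cf; have cm : continuous (fun x => m (f x)) by exact: continuous_minR.
  apply: continuous_addR.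
    apply: continuous_addR => //; apply: continuous_oppR.
    by apply: continuous_mulR => //; exact: continuous_cstR.
  apply: continuous_mulR; last exact: continuous_cstR.
  by apply: continuous_mulR => //; exact: continuous_cstR.
have cval (t : rel V) z : continuous (fun x : flag t => val x z).
  by apply: continuous_coord; exact: continuous_set_val.
exists (restr rho_flag), (@restr _ _ _ _ _ id sr); split.
- by apply: continuous_set_type => z; apply: (crho _ (fun x : flag r => val x)) => y;
    exact: cval.
- by apply: continuous_set_type => z; exact: cval.
- apply: (@homotopic_set_type _ _ _ _ _ _
    (fun (x : flag r) t => (fun z => (1 - t) * rho (val x) z + t * val x z))).
  + move=> z; have cfst : continuous (fun p : flag r * R => val p.1 z).
      exact: (continuous_after (cval r z) (@continuous_fst _ _)).
    have csnd : continuous (fun p : flag r * R => clamp p.2).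
      by apply: continuous_clamp; exact: continuous_snd.
    apply: continuous_addR; apply: continuous_mulR => //.
      by apply: continuous_addR; [exact: continuous_cstR|exact: continuous_oppR].
    apply: (crho _ (fun p : flag r * R => val p.1)) => y.
    exact: (continuous_after (cval r y) (@continuous_fst _ _)).
  + move=> x t /andP[t0 t1]; have rx := set_valP x; have [x0 x1 xr] := rx.
    split=> [z||y z yx zx].
    * by rewrite addr_ge0 // mulr_ge0 ?subr_ge0 ?rho_ge0.
    * by rewrite big_split /= -!mulr_sumr rho_sum // x1; ring.
    * have h y' : (1 - t) * rho (val x) y' + t * val x y' != 0 ->
        val x y' != 0 \/ y' = w /\ m (val x) != 0.
        move=> h; have [y0|y0] := pselect (val x y' = 0); last by left; exact/eqP.
        apply: (rho_supp rx); apply: contraNneq h => ->; by rewrite y0 !mulr0 addr0.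
      by apply: (supp_rel rx); exact: h.
  + by move=> x; apply/funext => z /=; ring.
  + by move=> x; apply/funext => z /=; ring.
- apply/homotopicP; rewrite (_ : _ \o _ = idfun).
    by apply: chomotopic_refl => x; exact: cvg_id.
  apply/funext => x; apply: val_inj; apply/funext => z /=.
  have sx := set_valP x; have rx := sr _ sx; have [x0 x1 xs] := sx.
  (* In the smaller complex u and v never both carry weight, so nothing is moved and [rho] is the
     identity. *)
  suff m0 : m (val x) = 0 by rewrite /rho m0 !mul0r subr0 addr0.
  apply/eqP; apply: contraT => m0.
  have := m_ge0 rx; rewrite le_eqVlt eq_sym (negbTE m0) /= /m lt_min => /andP[u0 v0].
  have := xs u v; rewrite !gt_eqF // => /(_ isT isT) /andP[_].
  by rewrite !eqxx.
Qed.
End Collapse.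

(** Vertices missed by [f] are not related to themselves and carry no weight, so reindexing along
    [f] is a homeomorphism. *)
Lemma flag_transfer V W (r : rel V) (f : W -> V) : injective f ->
  (forall v, r v v -> exists w, f w = v) ->
  homotopy_equivalent R (flag (fun a b => r (f a) (f b))) (flag r).
Proof.
move=> f_inj f_surj.
pose F (x : {ptws W -> R}) : {ptws V -> R} := fun v => \sum_(w | f w == v) x w.
pose G (y : {ptws V -> R}) : {ptws W -> R} := fun w => y (f w).
have Ff x w : F x (f w) = x w.
  by rewrite /F (bigD1 w) //= big1 ?addr0 // => w' /andP[/eqP/f_inj -> /eqP].
have F0 x v : F x v != 0 -> exists w, f w = v.
  apply: contra_neqP => nv; apply: big1 => w /eqP fw; case: nv; by exists w.
have FP x : flag_set (fun a b => r (f a) (f b)) x -> flag_set r (F x).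
  case=> x0 x1 xr; split=> [v||u v].
  - by apply: sumr_ge0 => w _.
  - by rewrite -x1 /F (partition_big f xpredT).
  - move=> Fu Fv; have [a au] := F0 _ _ Fu; have [b bv] := F0 _ _ Fv.
    by subst u v; move: Fu Fv; rewrite !Ff; exact: xr.
have yG y : flag_set r y -> F (G y) = y.
  case=> y0 y1 yr; apply/funext => v.
  have [v0|v0] := eqVneq (y v) 0.
    by rewrite v0 /F big1 // => w /eqP; rewrite /G => ->.
  by have [w <-] := f_surj v (yr _ _ v0 v0); rewrite Ff.
have GP y : flag_set r y -> flag_set (fun a b => r (f a) (f b)) (G y).
  move=> ry; have [y0 y1 yr] := ry; split=> [w||a b]; [exact: y0| |exact: yr].
  by rewrite -y1 -[in RHS](yG _ ry) /F (partition_big f xpredT).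
apply: (@heq_homeo _ _ _ (restr FP) (restr GP)).
- apply: continuous_set_type => v; apply: continuous_sumR => w.
  by apply: continuous_coord; exact: continuous_set_val.
- apply: continuous_set_type => w.
  by apply: continuous_coord; exact: continuous_set_val.
- by move=> x; apply: val_inj; apply/funext => w; exact: Ff.
- by move=> y; apply: val_inj; exact: (yG _ (set_valP y)).
Qed.

Lemma realization_IndE (G : sgraph) :
  realization R (Ind G) = flag (fun u v : G => ~~ adj u v).
Proof.
rewrite /realization /flag; congr (set_type _ : topologicalType).
apply/funext => x; apply/propext; split=> -[x0 x1 xr]; split=> //.
  move=> u v xu xv; move: xr; rewrite inE => /forall_inP /(_ u).
  by rewrite !inE xu => /(_ isT) /forall_inP /(_ v); rewrite !inE => ->.
rewrite inE; apply/forall_inP => u; rewrite inE => xu.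
by apply/forall_inP => v; rewrite inE => xv; exact: xr.
Qed.
End Flag.

Arguments flag R {V} r.

(** * Joins of points with cross-polytopes *)

Section Cross.
Context {R : realType}.

Lemma big_option (I : finType) (F : option I -> R) :
  \sum_o F o = F None + \sum_i F (Some i).
Proof.
rewrite (bigD1 None) //=; congr (_ + _).
rewrite (@reindex_omap _ _ _ _ _ Some id) /=; last by case.
by apply: eq_bigl => i; rewrite eqxx.
Qed.

(** The two ends of an edge cannot both carry weight. Their barycentric coordinates are therefore
    the positive parts of z and -z for a single signed coordinate z. *)
Definition ppart (z : R) : R := Num.max 0 z.

Lemma ppart_ge0 z : 0 <= ppart z. Proof. by rewrite /ppart le_max lexx. Qed.

Lemma ppart_id z : 0 <= z -> ppart z = z.
Proof. by move=> z0; rewrite /ppart max_r. Qed.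

Lemma ppart_eq0 z : z <= 0 -> ppart z = 0.
Proof. by move=> z0; rewrite /ppart max_l. Qed.

Lemma ppartM c z : 0 <= c -> ppart (c * z) = c * ppart z.
Proof. by move=> c0; rewrite /ppart maxr_pMr// mulr0. Qed.

Lemma ppart_norm z : ppart z + ppart (- z) = `|z|.
Proof.
case: (lerP 0 z) => z0; first by rewrite ppart_id // ppart_eq0 ?oppr_le0 // addr0
  ger0_norm.
by rewrite ppart_eq0 ?(ltW z0) // ppart_id ?add0r ?oppr_ge0 ?(ltW z0) // ltr0_norm.
Qed.

Lemma ppart_sub z : ppart z - ppart (- z) = z.
Proof.
case: (lerP 0 z) => z0; first by rewrite ppart_id // ppart_eq0 ?oppr_le0 // subr0.
by rewrite ppart_eq0 ?(ltW z0) // ppart_id ?sub0r ?opprK ?oppr_ge0 ?(ltW z0).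
Qed.

Lemma ppart_neq0 z : ppart z != 0 -> 0 < z.
Proof. by case: (ltrP 0 z) => // z0; rewrite ppart_eq0 ?eqxx. Qed.

Lemma continuous_ppart (X : topologicalType) (f : X -> R) :
  continuous f -> continuous (fun x => ppart (f x)).
Proof. by move=> cf; apply: continuous_maxR => //; exact: continuous_cstR. Qed.

Definition norm1 (I : finType) (v : I -> R) : R := \sum_i `|v i|.

Lemma norm1_ge0 (I : finType) (v : I -> R) : 0 <= norm1 v.
Proof. exact: sumr_ge0. Qed.

Lemma norm1_eq0 (I : finType) (v : I -> R) i : norm1 v = 0 -> v i = 0.
Proof.
by move/psumr_eq0P => h; apply/eqP; rewrite -normr_eq0; apply/eqP/h.
Qed.

Lemma norm1Z (I : finType) c (v : I -> R) :
  0 <= c -> norm1 (fun i => c * v i) = c * norm1 v.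
Proof.
by move=> c0; rewrite /norm1 mulr_sumr; apply: eq_bigr => i _; rewrite normrM ger0_norm.
Qed.

Lemma norm1_normalize (I : finType) (v : I -> R) :
  norm1 v != 0 -> norm1 (fun i => v i / norm1 v) = 1.
Proof.
move=> v0; rewrite /norm1 -/(norm1 v).
under eq_bigr => i _ do rewrite normrM normfV (ger0_norm (norm1_ge0 v)).
by rewrite -mulr_suml divff.
Qed.

Lemma continuous_norm1 (X : topologicalType) (I : finType) (v : X -> I -> R) :
  (forall i, continuous (fun x => v x i)) -> continuous (fun x => norm1 (v x)).
Proof. by move=> cv; apply: continuous_sumR => i; exact: continuous_normR. Qed.

Variables r' d : nat.
Local Notation r := r'.+1.

(* K_(r+1) together with d disjoint edges. *)
Definition cross_adj : rel (option 'I_r + 'I_d * bool)%type := fun u v =>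
  match u, v with
  | inl o, inl o' => o != o'
  | inr (i, b), inr (j, c) => (i == j) && (b != c)
  | _, _ => false
  end.

Definition cross : rel (option 'I_r + 'I_d * bool)%type :=
  fun u v => ~~ cross_adj u v.

(* The wedge of r copies of the l^1-sphere of dimension d, with base point the
   vector of coordinate 1 at None, embedded in their product.                 *)
Definition wedge_set : set {ptws 'I_r * option 'I_d -> R} :=
  [set p | (forall j, norm1 (fun i => p (j, i)) = 1) /\
    forall j k, j != k -> p (j, None) = 1 \/ p (k, None) = 1].

Lemma pole_coord (v : option 'I_d -> R) i :
  norm1 v = 1 -> v None = 1 -> v (Some i) = 0.
Proof.
rewrite /norm1 big_option => + v1; rewrite v1 normr1 => h.
have /(@norm1_eq0 _ (fun i => v (Some i))) -> // : norm1 (fun i => v (Some i)) = 0.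
by rewrite /norm1; lra.
Qed.

Lemma wedge_setP p : wedge_set p -> exists j0, forall j, j != j0 ->
  p (j, None) = 1 /\ forall i, p (j, Some i) = 0.
Proof.
move=> [p1 pp]; suff [j0 h] : exists j0, forall j, j != j0 -> p (j, None) = 1.
  exists j0 => j /h jN; split=> // i.
  exact: (@pole_coord (fun i => p (j, i)) i (p1 j) jN).
case: (pselect (exists j, p (j, None) <> 1)) => [[j0 h]|h].
  by exists j0 => j /pp [].
by exists ord0 => j _; apply: contrapT => jN; apply: h; exists j.
Qed.

Lemma crossP (x : {ptws _ -> R}) : flag_set cross x -> exists j0, forall j,
  j != j0 -> x (inl (Some j)) = 0.
Proof.
move=> [_ _ xr]; case: (pselect (exists j, x (inl (Some j)) != 0)) => [[j0 h]|h].
  exists j0 => j jj0; apply/eqP; apply: contraT => jN.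
  have := xr _ _ jN h; rewrite /cross /= negbK => /eqP[/eqP].
  by rewrite (negbTE jj0).
by exists ord0 => j _; apply/eqP; apply: contraT => jN; case: h; exists j.
Qed.

(* The point of the complex proportional to the vector with signed coordinate h
   on the segment from None to Some j (for the only j with hj j < 0, if any)
   and signed coordinates y on the d edges.                                   *)
Definition cross_pt (h : R) (hj : 'I_r -> R) (y : 'I_d -> R) :
    {ptws (option 'I_r + 'I_d * bool)%type -> R} :=
  fun w => match w with
           | inl None => ppart h
           | inl (Some j) => ppart (- hj j)
           | inr (i, b) => ppart (if b then y i else - y i)
           end / (`|h| + norm1 y).

(** Only [hj j0] can be negative, and its negative part is that of [h]. Hence [None] and the
    [Some j] never share weight, and the numerators add up to the denominator. *)
Lemma cross_pt_flag h hj y j0 : `|h| + norm1 y != 0 ->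
  (forall j, j != j0 -> 0 <= hj j) -> ppart (- hj j0) = ppart (- h) ->
  flag_set cross (cross_pt h hj y).
Proof.
move=> l0 hj0 hh; have lg0 : 0 < `|h| + norm1 y.
  by rewrite lt_neqAle eq_sym l0 addr_ge0 ?norm1_ge0.
have hjE j : j != j0 -> ppart (- hj j) = 0.
  by move=> /hj0 ?; rewrite ppart_eq0 // oppr_le0.
split.
- case=> [[j|]|[i b]]; rewrite /cross_pt; apply: divr_ge0; rewrite ?ppart_ge0 //;
    exact: ltW.
- rewrite big_sumType /= big_option -mulr_suml -!mulr_suml.
  rewrite -!mulrDl (bigD1 j0) //= big1 => [|j /hjE //].
  rewrite addr0 hh ppart_norm.
  rewrite (_ : \sum_i _ = norm1 y) ?divff //.
  rewrite (eq_bigr (fun p => ppart (if p.2 then y p.1 else - y p.1))); last by case.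
  rewrite -(pair_bigA _ (fun i b => ppart (if b then y i else - y i))) /=.
  by apply: eq_bigr => i _; rewrite big_bool /= ppart_norm.
- move=> u v; rewrite /cross_pt !mulf_eq0 !negb_or => /andP[+ _] /andP[+ _].
  have key j : ppart (- hj j) != 0 -> j = j0 /\ h < 0.
    have [->|/hjE ->] := eqVneq j j0; last by rewrite eqxx.
    by rewrite hh => /ppart_neq0; rewrite oppr_gt0.
  move: u v => [[j|]|[i b]] [[k|]|[l c]] //=; rewrite /cross /=.
  + by move=> /key[-> _] /key[-> _]; rewrite eqxx.
  + by move=> /key[_ ?] /ppart_neq0; lra.
  + by move=> /ppart_neq0 + /key[_]; lra.
  + move=> /ppart_neq0 + /ppart_neq0 +; rewrite negb_and negbK.
    have [->|//] := eqVneq i l.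
    by case: b; case: c => //=; lra.
Qed.

(** Homogeneity is what makes the normalisation in [to_wedge] invisible once [of_wedge] is
    applied. *)
Lemma cross_ptZ c h hj y : 0 < c ->
  cross_pt (c * h) (fun j => c * hj j) (fun i => c * y i) = cross_pt h hj y.
Proof.
move=> c0; have c0' := ltW c0; apply/funext => w; rewrite /cross_pt.
rewrite normrM (ger0_norm c0') norm1Z // -mulrDr invfM mulrA; congr (_ / _).
case: w => [[j|]|[i b]]; rewrite -?mulrN -?(fun_if (fun z => c * z)) ppartM //.
all: by rewrite mulrAC divff ?mul1r // gt_eqF.
Qed.

Lemma eq_cross_pt h hj hj' y :
  (forall j, ppart (- hj j) = ppart (- hj' j)) -> cross_pt h hj y = cross_pt h hj' y.
Proof. by move=> hh; apply/funext => -[[j|]|[i b]]; rewrite /cross_pt ?hh. Qed.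


Lemma continuous_cross_pt (X : topologicalType) (h : X -> R) hj y w :
  continuous h -> (forall j, continuous (fun x => hj x j)) ->
  (forall i, continuous (fun x => y x i)) ->
  (forall x, `|h x| + norm1 (y x) != 0) ->
  continuous (fun x => cross_pt (h x) (hj x) (y x) w).
Proof.
move=> ch chj cy l0; apply: continuous_mulR; last first.
  apply: continuous_invR => //; apply: continuous_addR; first exact: continuous_normR.
  exact: continuous_norm1.
case: w => [[j|]|[i b]]; apply: continuous_ppart => //; first exact: continuous_oppR.
by case: b => //; exact: continuous_oppR.
Qed.

Definition edge_coord (x : {ptws (option 'I_r + 'I_d * bool)%type -> R}) (i : 'I_d) :
  R :=
  x (inr (i, true)) - x (inr (i, false)).

Lemma edge_coordE x i : flag_set cross x ->
  x (inr (i, true)) = ppart (edge_coord x i) /\ x (inr (i, false)) = ppart (-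
    edge_coord x i).
Proof.
move=> [x0 _ xr]; have t0 := x0 (inr (i, true)); have f0 := x0 (inr (i, false)).
have [tE|tN] := eqVneq (x (inr (i, true))) 0.
  rewrite /edge_coord tE sub0r opprK (ppart_id f0) ppart_eq0 //.
  by rewrite oppr_le0.
have fE : x (inr (i, false)) = 0.
  apply/eqP; apply: contraT => fN.
  by have := xr _ _ tN fN; rewrite /cross /= eqxx.
by rewrite /edge_coord fE subr0 (ppart_id t0) ppart_eq0 // oppr_le0.
Qed.

Lemma crossE x : flag_set cross x -> exists j0, [/\ forall j, j != j0 -> x (inl (Some
  j)) = 0,
  \sum_j x (inl (Some j)) = x (inl (Some j0)),
  x (inl None) = 0 \/ x (inl (Some j0)) = 0,
  x (inl None) + x (inl (Some j0)) + norm1 (edge_coord x) = 1 &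
  0 <= x (inl None) /\ 0 <= x (inl (Some j0))].
Proof.
move=> rx; have [j0 xj0] := crossP rx; have [x0 x1 xr] := rx; exists j0.
have sE : \sum_j x (inl (Some j)) = x (inl (Some j0)).
  by rewrite (bigD1 j0) //= big1 ?addr0.
split=> //.
- have [?|aN] := eqVneq (x (inl None)) 0; [by left|right].
  by apply/eqP; apply: contraT => bN; have := xr _ _ aN bN.
- rewrite -x1 big_sumType /= big_option sE; congr (_ + _).
  rewrite (eq_bigr (fun p => x (inr (p.1, p.2)))); last by case.
  rewrite -(pair_bigA _ (fun i b => x (inr (i, b)))) /=.
  apply: eq_bigr => i _; rewrite big_bool /=.
  by have [-> ->] := edge_coordE i rx; rewrite ppart_norm.
Qed.

Lemma cross_ptK x : flag_set cross x ->
  cross_pt (x (inl None) - \sum_j x (inl (Some j)))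
    (fun j => x (inl None) - x (inl (Some j))) (edge_coord x) = x.
Proof.
move=> rx; have [j0 [xj0 -> a0 x1 [a_ge0 b_ge0]]] := crossE rx; have [x0 _ _] := rx.
have l1 : `|x (inl None) - x (inl (Some j0))| + norm1 (edge_coord x) = 1.
  rewrite -x1; congr (_ + _).
  by case: a0 => ->; rewrite ?sub0r ?subr0 ?add0r ?addr0 ?normrN ger0_norm.
apply/funext => w; rewrite /cross_pt l1 divr1.
case: w => [[j|]|[i b]].
- have [->|jj0] := eqVneq j j0.
    case: a0 => a0; first by rewrite a0 sub0r opprK ppart_id.
    by rewrite a0 subr0 ppart_eq0 // oppr_le0.
  by rewrite xj0 // subr0 ppart_eq0 // oppr_le0.
- case: a0 => a0; last by rewrite a0 subr0 ppart_id.
  by rewrite a0 sub0r ppart_eq0 // oppr_le0.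
- by have [tE fE] := edge_coordE i rx; case: b; rewrite ?tE ?fE.
Qed.

(** On the cone with apex [Some j], with s the weight of the apex and y the edge coordinates, the
    vector is (1 - 2s, s y): the base point at s = 0, its antipode at s = 1. The base of the cone is
    thus collapsed and the cone becomes the j-th sphere, while points without weight at [Some j] go
    to the base point. *)
Definition to_wedge_vec (x : {ptws (option 'I_r + 'I_d * bool)%type -> R}) j
    (o : option 'I_d) : R :=
  match o with
  | None => 1 - 2 * x (inl (Some j))
  | Some i => x (inl (Some j)) * edge_coord x i
  end.

Definition to_wedge (x : {ptws (option 'I_r + 'I_d * bool)%type -> R}) :
    {ptws 'I_r * option 'I_d -> R} :=
  fun jo => to_wedge_vec x jo.1 jo.2 / norm1 (to_wedge_vec x jo.1).

(** The j-th sphere goes onto the join of the two points [None] and [Some j] with the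
    cross-polytope. All spheres but one contribute zero to the sums, which therefore select the
    coordinates of the right sphere without a choice. *)
Definition of_wedge (p : {ptws 'I_r * option 'I_d -> R}) :
    {ptws (option 'I_r + 'I_d * bool)%type -> R} :=
  cross_pt (1 - \sum_j (1 - p (j, None))) (fun j => p (j, None))
    (fun i => \sum_j p (j, Some i)).

(** A zero would need weight 1/2 at [Some j] and no weight on the edges, leaving 1/2 for [None]; but
    [None] and [Some j] are never both in a face. *)
Lemma to_wedge_neq0 x j : flag_set cross x -> norm1 (to_wedge_vec x j) != 0.
Proof.
move=> rx; apply/negP => /eqP n0.
have [j0 [xj0 _ a0 x1 _]] := crossE rx.
have := norm1_eq0 None n0; rewrite /= => h.
have jE : j = j0 by apply/eqP; apply: contraT => /xj0; lra.
move: n0 h; rewrite {}jE {j} => n0 h.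
have y0 : norm1 (edge_coord x) = 0.
  apply: big1 => i _; have := norm1_eq0 (Some i) n0; rewrite /= => /eqP.
  rewrite mulf_eq0 => /orP[/eqP|/eqP ->]; last by rewrite normr0.
  by lra.
by case: a0; lra.
Qed.

Lemma to_wedge_pole x j : x (inl (Some j)) = 0 ->
  (forall i, to_wedge x (j, Some i) = 0) /\ to_wedge x (j, None) = 1.
Proof.
move=> xj; have n1 : norm1 (to_wedge_vec x j) = 1.
  rewrite /norm1 big_option /= xj mulr0 subr0 normr1 big1 ?addr0 // => i _.
  by rewrite mul0r normr0.
rewrite /to_wedge /= n1 xj; split=> [i|]; first by rewrite !mul0r.
by rewrite mulr0 subr0 divr1.
Qed.

Lemma to_wedge_set x : flag_set cross x -> wedge_set (to_wedge x).
Proof.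
move=> rx; split=> [j|j k jk]; first exact/norm1_normalize/to_wedge_neq0.
have [j0 xj0] := crossP rx; have [jE|/xj0/to_wedge_pole[]] := eqVneq j j0; last by left.
by right; have [] // : (forall i, to_wedge x (k, Some i) = 0) /\ to_wedge x (k, None)
  = 1;
  apply/to_wedge_pole/xj0; rewrite -jE eq_sym.
Qed.

Lemma of_wedgeE p j0 : wedge_set p ->
  (forall j, j != j0 -> p (j, None) = 1 /\ forall i, p (j, Some i) = 0) ->
  [/\ 1 - \sum_j (1 - p (j, None)) = p (j0, None),
  (fun i => \sum_j p (j, Some i)) = (fun i => p (j0, Some i)) &
  `|p (j0, None)| + norm1 (fun i => p (j0, Some i)) = 1].
Proof.
move=> [p1 _] pj0; split=> //.
- rewrite (bigD1 j0) //= big1 => [|j /pj0[-> _]]; last by rewrite subrr.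
  by rewrite addr0 opprB addrC subrK.
- apply/funext => i; rewrite (bigD1 j0) //= big1 ?addr0 // => j /pj0[_ ->] //.
- by rewrite -(p1 j0) /norm1 big_option.
Qed.

Lemma of_wedge_flag p : wedge_set p -> flag_set cross (of_wedge p).
Proof.
move=> pw; have [j0 pj0] := wedge_setP pw; have [hE yE l1] := of_wedgeE pw pj0.
rewrite /of_wedge hE yE.
apply: (@cross_pt_flag _ _ _ j0) => //; first by rewrite l1 oner_eq0.
by move=> j /pj0[-> _]; exact: ler01.
Qed.

(** Up to normalisation this interpolates linearly between the coordinates of x given by [cross_ptK]
    (t = 0) and those of [of_wedge (to_wedge x)] (t = 1). *)
Let cross_contraction (x : {ptws (option 'I_r + 'I_d * bool)%type -> R}) (t : R) :=
  cross_pt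
    ((1 - t) * (x (inl None) - \sum_j x (inl (Some j)))
      + t * (1 - 2 * \sum_j x (inl (Some j))))
    (fun j => (1 - t) * (x (inl None) - x (inl (Some j)))
      + t * (1 - 2 * x (inl (Some j))))
    (fun i => ((1 - t) + t * \sum_j x (inl (Some j))) * edge_coord x i).

(** The factor of the edge coordinates vanishes only for t = 1 and no weight on the points [Some j],
    where the first term is 1. If the edge coordinates vanish, all weight sits on one point and the
    first term is 1 at every time. *)
Let cross_contraction_neq0 x t : flag_set cross x -> 0 <= t <= 1 ->
  `|(1 - t) * (x (inl None) - \sum_j x (inl (Some j)))
      + t * (1 - 2 * \sum_j x (inl (Some j)))| +
  norm1 (fun i => ((1 - t) + t * \sum_j x (inl (Some j))) * edge_coord x i) != 0.
Proof.
move=> rx /andP[t0 t1]; have [j0 [_ -> a0 x1 [a_ge0 b_ge0]]] := crossE rx.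
have tb : 0 <= t * x (inl (Some j0)) by rewrite mulr_ge0.
have c0 : 0 <= 1 - t + t * x (inl (Some j0)) by lra.
rewrite norm1Z // paddr_eq0 ?normr_ge0 ?mulr_ge0 ?norm1_ge0 //.
rewrite normr_eq0 mulf_eq0; apply/negP => /andP[/eqP h /orP[/eqP c|/eqP y0]].
  have tE : t = 1 by lra.
  by move: c h; rewrite tE; lra.
by case: a0 => a0; move: h; rewrite y0 addr0 a0 ?add0r ?addr0 in x1; rewrite a0 x1; lra.
Qed.

(** The weight of [Some j] in [of_wedge p] is the negative part of [p (j, None)], so t = 0 gives
    [to_wedge_vec (of_wedge p) j]; t = 1 gives p. *)
Let wedge_contraction_vec (p : {ptws 'I_r * option 'I_d -> R}) (t : R) j o : R :=
  match o with
  | None => (1 - t) * (1 - 2 * ppart (- p (j, None))) + t * p (j, None)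
  | Some i => ((1 - t) * ppart (- p (j, None)) + t) * p (j, Some i)
  end.

Let wedge_contraction_neq0 p t j : wedge_set p -> 0 <= t <= 1 ->
  norm1 (wedge_contraction_vec p t j) != 0.
Proof.
move=> [p1 _] /andP[t0 t1]; have := p1 j; rewrite /norm1 !big_option /= => p1j.
have u0 := ppart_ge0 (- p (j, None)).
have c0 : 0 <= (1 - t) * ppart (- p (j, None)) by rewrite mulr_ge0 ?subr_ge0.
rewrite paddr_eq0 ?normr_ge0 ?sumr_ge0 //.
rewrite normr_eq0; apply/negP => /andP[/eqP h].
rewrite -[X in X == 0]/(norm1 (fun i => _ * p (j, Some i))) norm1Z; last by lra.
rewrite mulf_eq0 => /orP[/eqP c|/eqP y0].
  have tE : t = 0 by lra.
  by move: c h; rewrite tE; lra.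
have {}y0 : \sum_i `|p (j, Some i)| = 0 by [].
move: h p1j; rewrite y0 addr0; case: (lerP 0 (p (j, None))) => pj.
  by rewrite ppart_eq0 ?oppr_le0 // ger0_norm // => h p1j; move: h; rewrite p1j; lra.
rewrite ppart_id ?oppr_ge0 ?(ltW pj) // ltr0_norm // => h p1j.
by move: h; rewrite p1j (_ : p (j, None) = -1); lra.
Qed.

Lemma cross_wedge : homotopy_equivalent R (flag R cross) (set_type wedge_set).
Proof.
have cx w : continuous (fun x : flag R cross => val x w).
  by apply: continuous_coord; exact: continuous_set_val.
have cp w : continuous (fun p : set_type wedge_set => val p w).
  by apply: continuous_coord; exact: continuous_set_val.
have cxt w : continuous (fun q : flag R cross * R => val q.1 w).
  exact: (continuous_after (cx w) (@continuous_fst _ _)).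
have cpt w : continuous (fun q : set_type wedge_set * R => val q.1 w).
  exact: (continuous_after (cp w) (@continuous_fst _ _)).
have cy i : continuous (fun x : flag R cross => edge_coord (val x) i).
  by apply: continuous_addR => //; apply: continuous_oppR.
have cyt i : continuous (fun q : flag R cross * R => edge_coord (val q.1) i).
  exact: (continuous_after (cy i) (@continuous_fst _ _)).
have ct (X : topologicalType) : continuous (fun q : X * R => clamp q.2).
  by apply: continuous_clamp; exact: continuous_snd.
have ct' (X : topologicalType) : continuous (fun q : X * R => 1 - clamp q.2).
  apply: continuous_addR; first exact: continuous_cstR.
  by apply: continuous_oppR; exact: ct.
have ctx := ct (flag R cross); have ctx' := ct' (flag R cross).
have ctp := ct (set_type wedge_set); have ctp' := ct' (set_type wedge_set).
exists (restr to_wedge_set), (restr of_wedge_flag); split.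
- apply: continuous_set_type => -[j o].
  have cv o' : continuous (fun x : flag R cross => to_wedge_vec (val x) j o').
    case: o' => [i|].
      by apply: continuous_mulR.
    apply: continuous_addR; first exact: continuous_cstR.
    apply: continuous_oppR; apply: continuous_mulR => //; exact: continuous_cstR.
  apply: continuous_mulR => //; apply: continuous_invR.
    by move=> x; apply: to_wedge_neq0; exact: set_valP.
  by apply: continuous_norm1.
- apply: continuous_set_type => w.
  apply: continuous_cross_pt => //.
  + apply: continuous_addR; first exact: continuous_cstR.
    apply: continuous_oppR; apply: continuous_sumR => j.
    apply: continuous_addR; first exact: continuous_cstR.
    by apply: continuous_oppR.
  + by move=> i; apply: continuous_sumR => j.
  + move=> p; have pw := set_valP p; have [j0 pj0] := wedge_setP pw.
    by have [-> -> ->] := of_wedgeE pw pj0; exact: oner_neq0.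
- apply: homotopic_sym.
  apply: (@homotopic_set_type _ _ _ _ _ _
    (fun (x : flag R cross) t => cross_contraction (val x) t)).
  + move=> w; apply: continuous_cross_pt.
    * apply: continuous_addR; apply: continuous_mulR => //.
        apply: continuous_addR => //; apply: continuous_oppR.
        by apply: continuous_sumR.
      apply: continuous_addR; first exact: continuous_cstR.
      apply: continuous_oppR; apply: continuous_mulR; first exact: continuous_cstR.
      by apply: continuous_sumR.
    * move=> j; apply: continuous_addR; apply: continuous_mulR => //.
        by apply: continuous_addR => //; apply: continuous_oppR.
      apply: continuous_addR; first exact: continuous_cstR.
      by apply: continuous_oppR; apply: continuous_mulR => //; exact: continuous_cstR.
    * move=> i; apply: continuous_mulR => //.
      apply: continuous_addR => //; apply: continuous_mulR => //.
      by apply: continuous_sumR.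
    * by move=> [x t] /=; apply: cross_contraction_neq0;
        [exact: set_valP|exact: clamp_itv].
  + move=> x t t01; have rx := set_valP x; case/andP: (t01) => t0 t1.
    have := cross_contraction_neq0 rx t01.
    have [j0 [xj0 sE a0 x1 [a_ge0 b_ge0]]] := crossE rx => nz.
    apply: (@cross_pt_flag _ _ _ j0) => // [j /xj0 ->|]; last by rewrite sE.
    by rewrite mulr0 !subr0 mulr1 addr_ge0 ?mulr_ge0 ?subr_ge0.
  + move=> x; rewrite -[RHS](cross_ptK (set_valP x)) /cross_contraction.
    congr (cross_pt _ _ _); first by ring.
      by apply/funext => j; ring.
    by apply/funext => i; ring.
  + move=> x; rewrite [RHS]/(of_wedge (to_wedge (val x))) /of_wedge;
      have rx := set_valP x.
    have [j0 [xj0 sE _ _ _]] := crossE rx.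
    have [j /xj0/to_wedge_pole[]//|-> -> _] := of_wedgeE (j0 := j0) (to_wedge_set rx).
    set n := norm1 (to_wedge_vec (val x) j0).
    have n0 : 0 < n^-1.
      by rewrite invr_gt0 lt_neqAle eq_sym to_wedge_neq0 ?norm1_ge0.
    (* Rescale the endpoint of the contraction by 1/n, the factor that [to_wedge] introduces on
       sphere [j0]; the remaining indices j only matter through a negative part, which is 0 on both
       sides. *)
    rewrite /cross_contraction -(cross_ptZ _ _ _ n0) sE; apply/esym.
    rewrite (_ : to_wedge _ _ = n^-1 * ((1 - 1) * (val x (inl None) -
      val x (inl (Some j0))) + 1 * (1 - 2 * val x (inl (Some j0))))); last first.
      by rewrite /to_wedge /= -/n; ring.
    rewrite (_ : (fun i => to_wedge _ (j0, Some i)) = (fun i => n^-1 * ((1 - 1 +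
      1 * val x (inl (Some j0))) * edge_coord (val x) i))); last first.
      by apply/funext => i; rewrite /to_wedge /= -/n; ring.
    apply: eq_cross_pt => j; have [->|jj0] := eqVneq j j0.
      by congr (ppart (- _)); rewrite /to_wedge /= -/n; ring.
    have [|_ ->] := @to_wedge_pole (val x) j; first exact: xj0.
    by rewrite (xj0 _ jj0) !ppart_eq0 // oppr_le0 ?ler01 // mulr_ge0 ?(ltW n0) //; lra.
- apply: (@homotopic_set_type _ _ _ _ _ _ (fun (p : set_type wedge_set) t =>
    (fun jo => wedge_contraction_vec (val p) t jo.1 jo.2 /
      norm1 (wedge_contraction_vec (val p) t jo.1)))).
  + move=> [j o].
    have cv o' : continuous (fun q : set_type wedge_set * R =>
        wedge_contraction_vec (val q.1) (clamp q.2) j o').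
      have cu : continuous (fun q : set_type wedge_set * R => ppart (- val q.1 (j,
        None))).
        apply: continuous_ppart; by apply: continuous_oppR.
      case: o' => [i|].
        apply: continuous_mulR => //; apply: continuous_addR => //.
        by apply: continuous_mulR.
      apply: continuous_addR; last by apply: continuous_mulR.
      apply: continuous_mulR => //; apply: continuous_addR;
        first exact: continuous_cstR.
      by apply: continuous_oppR; apply: continuous_mulR => //; exact: continuous_cstR.
    apply: continuous_mulR => //; apply: continuous_invR;
      last by apply: continuous_norm1.
    by move=> q; apply: wedge_contraction_neq0; [exact: set_valP|exact: clamp_itv].
  + move=> p t t01; have pw := set_valP p; split=> [j|j k jk].
      by apply: norm1_normalize; exact: wedge_contraction_neq0.
    have key l : val p (l, None) = 1 -> wedge_contraction_vec (val p) t l None /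
        norm1 (wedge_contraction_vec (val p) t l) = 1.
      move=> l1; suff -> : norm1 (wedge_contraction_vec (val p) t l) = 1.
        by rewrite /= l1 ppart_eq0 ?oppr_le0 //; lra.
      rewrite /norm1 big_option /= big1 => [|i _]; last first.
        by rewrite (@pole_coord (fun o => val p (l, o))) ?mulr0 ?normr0 //; case: pw.
      by rewrite l1 ppart_eq0 ?oppr_le0 // mulr0 subr0 !mulr1 subrK normr1 addr0.
    by case: pw => _ /(_ _ _ jk)[/key|/key]; [left|right].
  + move=> p; have pw := set_valP p; have [j0 pj0] := wedge_setP pw.
    have [hE yE l1] := of_wedgeE pw pj0.
    suff vE j o : to_wedge_vec (of_wedge (val p)) j o = wedge_contraction_vec (val p)
      0 j o.
      apply/funext => -[j o]; rewrite /restr /to_wedge /= vE; congr (_ / norm1 _).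
      by apply/funext => o'; rewrite vE.
    have eE i : edge_coord (of_wedge (val p)) i = val p (j0, Some i).
      rewrite /edge_coord /of_wedge /cross_pt hE yE l1 !divr1.
      by rewrite ppart_sub; exact: (congr1 (fun y => y i) yE).
    have sE : of_wedge (val p) (inl (Some j)) = ppart (- val p (j, None)).
      by rewrite /of_wedge /cross_pt hE yE l1 divr1.
    case: o => [i|]; rewrite /to_wedge_vec /wedge_contraction_vec sE; last by ring.
    rewrite eE; have [->|/pj0[-> _]] := eqVneq j j0; first by ring.
    by rewrite ppart_eq0 ?oppr_le0 //; ring.
  + move=> p; have [p1 _] := set_valP p; apply/funext => -[j o].
    suff vE o' : wedge_contraction_vec (val p) 1 j o' = val p (j, o').
      rewrite [LHS]/(wedge_contraction_vec (val p) 1 j o /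
        norm1 (wedge_contraction_vec (val p) 1 j)) vE.
      have -> : norm1 (wedge_contraction_vec (val p) 1 j) = 1.
        by rewrite -[RHS](p1 j); congr (norm1 _); apply/funext => o'; exact: vE.
      exact: divr1.
    by case: o' => [i|]; rewrite /wedge_contraction_vec; ring.
Qed.
End Cross.

(** * Wedges of spheres *)

Section Spheres.
Context {R : realType}.

Lemma closed_cover_continuous (X Y : topologicalType) (I : finType)
    (B : I -> set X) (f : X -> Y) :
  (forall i, closed (B i)) -> (forall x, exists i, B i x) ->
  (forall i, {within B i, continuous f}) -> continuous f.
Proof.
move=> clB covB cf; apply/continuous_subspace_setT.
have -> : [set: X] = \big[setU/set0]_(i <- enum I) B i.
  apply/esym; rewrite -subTset => x _; have [i Bx] := covB x.
  by rewrite -bigcup_seq; exists i => //=; rewrite mem_enum.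
elim: (enum I) => [|i s IH]; first by rewrite big_nil; exact: continuous_subspace0.
rewrite big_cons; apply: withinU_continuous => //.
by apply: closed_bigsetU => j _; exact: clB.
Qed.

Lemma continuous_rV (X : topologicalType) n (f : X -> 'rV[R]_n) :
  (forall i, continuous (fun x => f x ord0 i)) -> continuous f.
Proof.
move=> cf x A [P fP PA].
have h : nbhs x (fun y => forall i, P ord0 i (f y ord0 i)).
  by apply: filter_forall => i; apply: cf; exact: fP.
by apply: filterS h => y Py; apply: PA => i j; rewrite (ord1 i).
Qed.

Variable d : nat.

Definition norm2 (v : option 'I_d -> R) : R := Num.sqrt (\sum_o v o ^+ 2).

(** Radial projection from the l^1-sphere to the Euclidean one. [None] becomes coordinate 0, so that
    the base vector becomes [pole]. *)
Definition to_sphere (v : option 'I_d -> R) : 'rV[R]_d.+1 :=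
  \row_i (v (unlift ord0 i) / norm2 v).

Definition sphere_coord (x : 'rV[R]_d.+1) (o : option 'I_d) : R :=
  x ord0 (oapp (lift ord0) ord0 o).

Definition of_sphere (x : 'rV[R]_d.+1) (o : option 'I_d) : R :=
  sphere_coord x o / norm1 (sphere_coord x).

Lemma sum_option_ord (F : 'I_d.+1 -> R) :
  \sum_i F i = \sum_o F (oapp (lift ord0) ord0 o).
Proof. by rewrite big_ord_recl big_option. Qed.

Lemma sphere_coordP x : @sphere_set R d x -> \sum_o sphere_coord x o ^+ 2 = 1.
Proof. by rewrite /sphere_set /= sum_option_ord. Qed.

Lemma norm2_gt0 (v : option 'I_d -> R) : norm1 v = 1 -> 0 < norm2 v.
Proof.
move=> v1; rewrite sqrtr_gt0 lt_neqAle sumr_ge0 ?andbT => [|o _]; last exact: sqr_ge0.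
rewrite eq_sym; apply/eqP => /psumr_eq0P h.
have : norm1 v = 0.
  apply: big1 => o _; apply/eqP; rewrite normr_eq0 -sqrf_eq0; apply/eqP/h => //.
  by move=> ? _; exact: sqr_ge0.
by rewrite v1 => /eqP; rewrite oner_eq0.
Qed.

Lemma to_sphere_set v : norm1 v = 1 -> @sphere_set R d (to_sphere v).
Proof.
move=> v1; have n0 := norm2_gt0 v1; rewrite /sphere_set /= sum_option_ord.
under eq_bigr => o _ do rewrite mxE exprMn.
rewrite -mulr_suml (eq_bigr (fun o => v o ^+ 2)) => [|[i|] _ /=]; last 2 first.
- by rewrite liftK.
- by rewrite unlift_none.
rewrite -(@sqr_sqrtr _ (\sum_o _)) ?sumr_ge0 // => [|o _]; last exact: sqr_ge0.
by rewrite -/(norm2 v) -exprMn divff ?expr1n // gt_eqF.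
Qed.

Lemma of_sphere_neq0 x : @sphere_set R d x -> norm1 (sphere_coord x) != 0.
Proof.
move=> /sphere_coordP x1; apply/eqP => n0; move: x1.
rewrite big1 => [/eqP|o _]; first by rewrite eq_sym oner_eq0.
by rewrite (norm1_eq0 o n0) expr0n.
Qed.

Lemma norm1_of_sphere x : @sphere_set R d x -> norm1 (of_sphere x) = 1.
Proof. by move=> /of_sphere_neq0/norm1_normalize. Qed.

Lemma to_sphereK v : norm1 v = 1 -> of_sphere (to_sphere v) = v.
Proof.
move=> v1; have n0 := norm2_gt0 v1.
have cE : sphere_coord (to_sphere v) = (fun o => (norm2 v)^-1 * v o).
  apply/funext => o; rewrite /sphere_coord mxE mulrC.
  by case: o => [i|] /=; rewrite ?liftK ?unlift_none.
apply/funext => o; rewrite /of_sphere cE norm1Z ?invr_ge0 ?(ltW n0) // v1 mulr1.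
by rewrite invrK mulrAC mulVf ?mul1r // gt_eqF.
Qed.

Lemma of_sphereK x : @sphere_set R d x -> to_sphere (of_sphere x) = x.
Proof.
move=> xs; have n0 := of_sphere_neq0 xs.
have n_gt0 : 0 < norm1 (sphere_coord x) by rewrite lt_neqAle eq_sym n0 norm1_ge0.
have nE : norm2 (of_sphere x) = (norm1 (sphere_coord x))^-1.
  rewrite /norm2 /of_sphere; under eq_bigr => o _ do rewrite exprMn.
  by rewrite -mulr_suml sphere_coordP // mul1r sqrtr_sqr ger0_norm // invr_ge0 ltW.
apply/rowP => i; rewrite mxE nE invrK /of_sphere divfK //.
by rewrite /sphere_coord; case: unliftP => [j ->|->].
Qed.

Lemma of_sphere_pole :
  of_sphere (val (pole R d)) = (fun o => (o == None)%:R).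
Proof.
have cE : sphere_coord (val (pole R d)) = (fun o => (o == None)%:R).
  by apply/funext => -[i|]; rewrite /sphere_coord /= mxE eqxx.
rewrite /of_sphere cE (_ : norm1 _ = 1); first by apply/funext => o; rewrite divr1.
by rewrite /norm1 big_option /= normr1 big1 ?addr0 // => i _; rewrite normr0.
Qed.

Lemma to_sphere_pole v : norm1 v = 1 -> v None = 1 -> to_sphere v = val (pole R d).
Proof.
move=> v1 vN; rewrite -[RHS]of_sphereK; last exact: (set_valP (pole R d)).
congr to_sphere; rewrite of_sphere_pole; apply/funext => -[i|] //=.
exact: pole_coord.
Qed.

Lemma continuous_of_sphere (X : topologicalType) (f : X -> sphere R d) o :
  continuous f -> continuous (fun x => of_sphere (val (f x)) o).
Proof.
move=> cf.
have cc o' : continuous (fun x => sphere_coord (val (f x)) o').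
  have cv := continuous_after (@continuous_set_val _ (@sphere_set R d)) cf.
  exact: (continuous_after (@coord_continuous R 1 d.+1 ord0 _) cv).
apply: continuous_mulR => //; apply: continuous_invR; last exact: continuous_norm1.
by move=> x; apply: of_sphere_neq0; exact: set_valP.
Qed.

Lemma continuous_to_sphere (X : topologicalType) (v : X -> option 'I_d -> R)
    (v1 : forall x, norm1 (v x) = 1) :
  (forall o, continuous (fun x => v x o)) ->
  continuous (fun x => SigSub (mem_set (to_sphere_set (v1 x))) : sphere R d).
Proof.
move=> cv; apply: continuous_comp_initial; apply: continuous_rV => i.
rewrite (_ : (fun x => _) = (fun x => v x (unlift ord0 i) / norm2 (v x))); last first.
  by apply/funext => x /=; rewrite mxE.
apply: continuous_mulR => //; apply: continuous_invR.
  by move=> x; rewrite gt_eqF // norm2_gt0.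
apply: (continuous_after (@sqrt_continuous R)); apply: continuous_sumR => o.
by apply: (@continuous_mulR _ _ (fun x => v x o) (fun x => v x o)).
Qed.

Lemma wedge_set1_sphere :
  homotopy_equivalent R (set_type (@wedge_set R 0 d)) (sphere R d).
Proof.
have cp w : continuous (fun p : set_type (@wedge_set R 0 d) => val p w).
  by apply: continuous_coord; exact: continuous_set_val.
have p1 (p : set_type (@wedge_set R 0 d)) : norm1 (fun o => val p (ord0, o)) = 1.
  by have [] := set_valP p.
have xw (x : sphere R d) : wedge_set (r' := 0) (fun jo => of_sphere (val x) jo.2).
  split=> [j|j k]; first exact: norm1_of_sphere (set_valP x).
  by rewrite (ord1 j) (ord1 k) eqxx.
apply: (heq_homeo
  (f := fun p => SigSub (mem_set (to_sphere_set (p1 p))) : sphere R d)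
  (g := fun x => SigSub (mem_set (xw x)) : set_type (@wedge_set R 0 d))).
- exact: (@continuous_to_sphere _
    (fun (p : set_type (@wedge_set R 0 d)) o => val p (ord0, o)) p1 (fun o => cp
      (ord0, o))).
- apply: continuous_set_type => -[j o].
  by apply: (continuous_of_sphere (f := id)) => x; exact: cvg_id.
- move=> p; apply: val_inj; apply/funext => -[j o].
  by rewrite (ord1 j); exact: (congr1 (fun v => v o) (to_sphereK (p1 p))).
- by move=> x; apply: val_inj; exact: (of_sphereK (set_valP x)).
Qed.

Variable r' : nat.
Local Notation r := r'.+1.

Local Notation wlift j x :=
  (@wedge_lift _ (fun _ : 'I_r => sphere R d) (fun _ => pole R d) j x).

Let lift_pt (l : 'I_r) (x : sphere R d) : {ptws 'I_r * option 'I_d -> R} :=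
  fun jo => if jo.1 == l then of_sphere (val x) jo.2 else (jo.2 == None)%:R.

Let norm1_None : norm1 (fun o : option 'I_d => (o == None)%:R : R) = 1.
Proof. by rewrite /norm1 big_option /= normr1 big1 ?addr0 // => i _;
  rewrite normr0. Qed.

Let lift_ptP l x : wedge_set (lift_pt l x).
Proof.
split=> [j|j k jk]; rewrite /lift_pt /=.
  by case: eqP => _; [exact: norm1_of_sphere (set_valP x)|exact: norm1_None].
have [jl|] := eqVneq j l; last by left.
by rewrite -jl eq_sym (negbTE jk); right.
Qed.

Let of_wedge_spheres : wedge_spheres R r d -> set_type (@wedge_set R r' d) :=
  wedge_fun (fun l (x : sphere R d) => SigSub (mem_set (lift_ptP l x))).

Let lift_pt_pole l l' : (fun l (x : sphere R d) => SigSub (mem_set (lift_ptP l x))) l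
  (pole R d) =
  (fun l (x : sphere R d) => SigSub (mem_set (lift_ptP l x))) l' (pole R d)
  :> set_type (@wedge_set R r' d).
Proof.
have lE k : lift_pt k (pole R d) = (fun jo => (jo.2 == None)%:R).
  by apply/funext => -[j o]; rewrite /lift_pt of_sphere_pole; case: ifP.
by apply: val_inj; rewrite [LHS]lE [RHS]lE.
Qed.

Let wedge_norm1 (p : set_type (@wedge_set R r' d)) j :
  norm1 (fun o => val p (j, o)) = 1.
Proof. by have [] := set_valP p. Qed.

Let sphere_at (p : set_type (@wedge_set R r' d)) (j : 'I_r) : sphere R d :=
  SigSub (mem_set (to_sphere_set (wedge_norm1 p j))).

(** At most one coordinate is off the base point. If there is none, the default [ord0] is harmless,
    since the lifts of the poles of all spheres coincide in the wedge. *)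
Let to_wedge_spheres (p : set_type (@wedge_set R r' d)) : wedge_spheres R r d :=
  let j := odflt ord0 [pick j | val p (j, None) != 1] in
  wlift j (sphere_at p j).

Let sphere_at_pole p j : val p (j, None) = 1 -> sphere_at p j = pole R d.
Proof. by move=> pj; apply: val_inj; apply: to_sphere_pole. Qed.

Let to_wedge_spheresE p j : (forall k, k != j -> val p (k, None) = 1) ->
  to_wedge_spheres p = wlift j (sphere_at p j).
Proof.
move=> pk; rewrite /to_wedge_spheres; case: pickP => [l pl|h] /=.
  by have [->//|/pk/eqP] := eqVneq l j; rewrite (negbTE pl).
have h1 k : val p (k, None) = 1 by apply/eqP; move: (h k) => /negbFE.
rewrite !sphere_at_pole //.
exact: (@wedge_liftE _ (fun _ : 'I_r => sphere R d) _ j (pole R d) ord0 (pole R d)).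
Qed.

Lemma wedge_set_spheres :
  homotopy_equivalent R (set_type (@wedge_set R r' d)) (wedge_spheres R r d).
Proof.
have cp w : continuous (fun p : set_type (@wedge_set R r' d) => val p w).
  by apply: continuous_coord; exact: continuous_set_val.
apply: (heq_homeo (f := to_wedge_spheres) (g := of_wedge_spheres)).
(* On [B j] all spheres but the j-th are at the base point, so the choice may be replaced by j.
   Coordinates are at most 1, so the inequality expresses equality with 1 as a closed condition. *)
- pose B (j : 'I_r) : set (set_type (@wedge_set R r' d)) :=
    \bigcap_(k in [set k | k != j]) [set p | 1 <= val p (k, None)].
  have val_le1 (p : set_type (@wedge_set R r' d)) k : val p (k, None) <= 1.
    rewrite -(wedge_norm1 p k) /norm1 big_option.
    by apply: (le_trans (ler_norm _)); rewrite lerDl sumr_ge0.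
  apply: (@closed_cover_continuous _ _ _ B).
  + move=> j; apply: closed_bigI => k _.
    by apply: closed_ler => //; exact: continuous_cstR.
  + move=> p; have [j0 pj0] := wedge_setP (set_valP p).
    by exists j0 => k /= /pj0[-> _].
  + move=> j; apply: (@subspace_eq_continuous _ (B j) _
      (fun p => wlift j (sphere_at p j)) to_wedge_spheres).
      move=> p /set_mem Bp; rewrite (@to_wedge_spheresE p j) // => k kj.
      by apply/eqP; rewrite eq_le val_le1; exact: Bp.
    have c : continuous (fun p => wlift j (sphere_at p j)).
      apply: (continuous_after (@wedge_lift_continuous _ _ _ j)).
      exact: (@continuous_to_sphere _
        (fun (p : set_type (@wedge_set R r' d)) o => val p (j, o))
        (fun p => wedge_norm1 p j) (fun o => cp (j, o))).
    exact: continuous_subspaceT c.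
- apply: wedge_fun_continuous => [l|l l']; last exact: lift_pt_pole.
  apply: continuous_set_type => -[j o]; rewrite /= /lift_pt /=.
  case: eqP => _; last exact: continuous_cstR.
  by apply: (continuous_of_sphere (f := id)) => x; exact: cvg_id.
- move=> p; have [j0 pj0] := wedge_setP (set_valP p).
  rewrite (@to_wedge_spheresE p j0); last by move=> k /pj0[].
  rewrite /of_wedge_spheres wedge_lift_funE; last exact: lift_pt_pole.
  apply: val_inj; apply/funext => -[j o];
    rewrite [LHS]/(lift_pt j0 _ (j, o)) /lift_pt /=.
  have [->|/pj0[pN pS]] := eqVneq j j0.
    exact: (congr1 (fun v => v o) (to_sphereK (wedge_norm1 p j0))).
  by case: o => [i|]; rewrite ?pN ?pS.
- move=> w; have : [set: wedge_spheres R r d] w by [].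
  rewrite -[X in X w](wedgeTE (fun _ : 'I_r => pole R d)) => -[l _ [x _ <-]].
  rewrite /of_wedge_spheres wedge_lift_funE; last exact: lift_pt_pole.
  rewrite (@to_wedge_spheresE _ l) => [|k kl];
    last by rewrite /= /lift_pt /= (negbTE kl).
  congr wedge_lift; apply: val_inj; rewrite -[RHS](of_sphereK (set_valP x)).
  congr to_sphere; apply/funext => o; rewrite /= /lift_pt /= eqxx //.
Qed.
End Spheres.

(** * Homotopy-preserving graph moves *)

Ltac simpl_neq := repeat match goal with
  | H : is_true (?x != ?y) |- context [?x == ?y] => rewrite (negbTE H)
  | H : is_true (?x != ?y) |- context [?y == ?x] => rewrite (eq_sym y x) (negbTE H)
  | |- context [?x == ?x] => rewrite (eqxx x)
  end.

Ltac vertex_cases := repeat (simpl_neq; rewrite /= ?(andbF, andbT, orbT, orbF) //;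
  try match goal with
  | |- context [?x == ?y] => case: (eqVneq x y) => [->|?]
  end).

Section GraphMoves.
Context {R : realType} {V : finType}.
Implicit Types (S D : pred V) (e : rel V).

Definition ind S e : rel V := fun x y => [&& S x, S y & ~~ e x y].

Definition same_pair (u v x y : V) : bool :=
  (x == u) && (y == v) || (x == v) && (y == u).

Lemma same_pairC u v x y : same_pair u v x y = same_pair u v y x.
Proof. by rewrite /same_pair orbC andbC [X in _ || X]andbC. Qed.

Definition gequiv S e S' e' : Prop :=
  homotopy_equivalent R (flag R (ind S e)) (flag R (ind S' e')).

Lemma gequiv_sym S e S' e' : gequiv S e S' e' -> gequiv S' e' S e.
Proof. exact: heq_sym. Qed.

Lemma gequiv_trans S1 e1 S e S2 e2 :
  gequiv S e S1 e1 -> gequiv S1 e1 S2 e2 -> gequiv S e S2 e2.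
Proof. exact: heq_trans. Qed.

Lemma eq_gequiv S S' e e' : S =1 S' ->
  (forall x y, S x -> S y -> e x y = e' x y) -> irreflexive e -> irreflexive e' ->
  gequiv S e S' e'.
Proof.
move=> SS ee irr irr'; rewrite /gequiv /flag (@eq_flag_set _ _ _ (ind S' e')).
- exact: heq_refl.
- move=> u v /and3P[Su _ _] /and3P[Sv _ _].
  by rewrite /ind -!SS Su Sv ee.
- by move=> u /and3P[Su _ _]; rewrite /ind irr SS Su.
Qed.

Lemma ind_sym S e : symmetric e -> symmetric (ind S e).
Proof. by move=> sy x y; rewrite /ind sy andbCA. Qed.

(** This is [collapse] with u = v; the vertex with the larger neighbourhood is the one that goes. *)
Lemma remove_vertex S e u w : symmetric e -> irreflexive e -> S w -> w != u ->
  (forall z, S z -> e w z -> e u z) ->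
  gequiv S e [pred x | S x && (x != u)] e.
Proof.
move=> sy irr Sw wu dom.
have := @collapse R V (ind S e) u u w (ind_sym S sy) wu wu.
rewrite /ind Sw irr => /(_ isT) h; apply: heq_trans (h _) _ => [z|].
  move=> /and3P[Sz _ _] /and3P[_ _ uz] _; rewrite Sz /=.
  by apply: contra uz; exact: dom.
rewrite /gequiv /flag (@eq_flag_set _ _ _ (ind [pred x | S x && (x != u)] e)).
- exact: heq_refl.
- move=> x y; rewrite !orbb !andbb => /andP[/and3P[Sx _ _] xu] /andP[/and3P[Sy _ _] yu].
  by rewrite /ind /= Sx Sy xu yu (negbTE xu) /= andbT.
- by move=> x; rewrite /ind /= orbb andbb => /and3P[/andP[-> ->] _ ->].
Qed.

(** Read backwards it deletes the edge uv, domination being then tested in the graph without that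
    edge. *)
Lemma add_edge S e e' u v w : symmetric e -> irreflexive e -> irreflexive e' ->
  S w -> w != u -> w != v -> u != v ->
  (forall z, S z -> e w z -> e u z || e v z) ->
  (forall x y, S x -> S y -> e' x y = e x y || same_pair u v x y) ->
  gequiv S e S e'.
Proof.
move=> sy irr irr' Sw wu wv uv dom ee.
have := @collapse R V (ind S e) u v w (ind_sym S sy) wu wv.
rewrite /ind Sw irr => /(_ isT) h; apply: heq_trans (h _) _ => [z|].
  move=> /and3P[Sz _ _] /and3P[_ _ uz] /and3P[_ _ vz]; rewrite Sz /=.
  by apply: contraNN uz => /(dom z Sz)/orP[//|ez]; rewrite ez in vz.
rewrite /gequiv /flag (@eq_flag_set _ _ _ (ind S e')).
- exact: heq_refl.
- move=> x y /andP[/and3P[Sx _ _] _] /andP[/and3P[Sy _ _] _].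
  by rewrite /ind /= Sx Sy ee // -negb_or.
- move=> x /and3P[Sx _ _]; rewrite Sx irr /=.
  by have [->|_] := eqVneq x u; rewrite ?(negbTE uv) ?andbF.
Qed.

(** One [w] serves for all deletions: it lies outside [D], and domination persists in induced
    subgraphs. *)
Lemma remove_vertices S D e w : symmetric e -> irreflexive e -> S w -> ~~ D w ->
  (forall u z, D u -> S z -> e w z -> e u z) ->
  gequiv S e [pred x | S x && ~~ D x] e.
Proof.
move=> sy irr Sw Dw dom.
have h (s : seq V) : all D s -> gequiv S e [pred x | S x && (x \notin s)] e.
  elim: s => [_|u s IH /= /andP[Du Ds]].
    by apply: eq_gequiv => // x; rewrite /= andbT.
  apply: gequiv_trans (IH Ds) _.
  apply: gequiv_trans (@remove_vertex _ e u w sy irr _ _ _) _.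
  - by rewrite /= Sw; apply: contra Dw => /(allP Ds).
  - by apply: contraNneq Dw => ->.
  - by move=> z /= /andP[Sz _]; exact: dom.
  - by apply: eq_gequiv => // x; rewrite /= inE negb_or -andbA (andbC (x \notin s)).
apply: gequiv_trans (h (enum D) _) _; first by apply/allP => x; rewrite mem_enum.
by apply: eq_gequiv => // x; rewrite /= mem_enum.
Qed.

(** On the path p, a, b, c, q: add pq (b sees only a and c, neighbours of p and q); delete ap (c
    sees only b and q, and q now sees p); delete c (a sees only b, a neighbour of c). The edge ab is
    left isolated and pq closes the shortened path. *)
Lemma path_reduce S e e' p a b c q : symmetric e -> irreflexive e -> irreflexive e' ->
  uniq [:: p; a; b; c; q] -> all S [:: p; a; b; c; q] ->
  (forall z, S z -> e a z = (z == p) || (z == b)) ->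
  (forall z, S z -> e b z = (z == a) || (z == c)) ->
  (forall z, S z -> e c z = (z == b) || (z == q)) ->
  (forall x y, S x -> S y -> x != c -> y != c ->
    e' x y = e x y && ~~ same_pair a p x y || same_pair p q x y) ->
  gequiv S e [pred x | S x && (x != c)] e'.
Proof.
move=> sy irr irr' /=; rewrite !inE !negb_or -!andbA.
move=> /and5P[pa pb pc pq /and5P[ab ac aq bc /and3P[bq cq _]]].
move=> /and5P[Sp Sa Sb Sc /andP[Sq _]] Na Nb Nc ee.
pose e1 x y := e x y || same_pair p q x y.
pose e2 x y := e1 x y && ~~ same_pair a p x y.
have sy1 : symmetric e1 by move=> x y; rewrite /e1 sy same_pairC.
have sy2 : symmetric e2 by move=> x y; rewrite /e2 sy1 same_pairC.
have irr1 : irreflexive e1.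
  move=> x; rewrite /e1 irr /= /same_pair.
  by have [->|_] := eqVneq x p; rewrite ?(negbTE pq) ?andbF.
have irr2 : irreflexive e2 by move=> x; rewrite /e2 irr1.
have eE : ((e a p = true) * (e p a = true) * (e a b = true) * (e b a = true) *
    (e b c = true) * (e c b = true) * (e c q = true) * (e q c = true))%type.
  by do !split; rewrite ?Na ?Nb ?Nc // ?eqxx ?orbT //;
    rewrite sy ?Na ?Nb ?Nc // ?eqxx ?orbT.
apply: (@gequiv_trans S e1).
  apply: (@add_edge _ _ _ p q b) => //; rewrite 1?eq_sym // => z Sz; rewrite Nb //.
  by vertex_cases; rewrite ?eE ?orbT.
apply: (@gequiv_trans S e2).
  apply: gequiv_sym; apply: (@add_edge _ _ _ a p c) => //; rewrite 1?eq_sym //.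
    move=> z Sz; rewrite /e2 /e1 Nc // Na // /same_pair.
    by vertex_cases.
  move=> x y Sx Sy; rewrite /e2 /e1 /same_pair.
  by vertex_cases; rewrite ?eE.
apply: (gequiv_trans (@remove_vertex S e2 c a sy2 irr2 Sa ac _)).
  by move=> z Sz; rewrite /e2 /e1 Na // Nc // /same_pair; vertex_cases.
apply: eq_gequiv => // x y /andP[Sx xc] /andP[Sy yc].
by rewrite ee // /e2 /e1 /same_pair; vertex_cases.
Qed.

(** For four consecutive columns: add x0y3 with witness y1 and y0x3 with witness x1; these new edges
    make y1 a witness for deleting x2x3 and y2 one for deleting x0x1. Then x2 dominates y1 and x1
    dominates y2. What remains of the middle columns is the isolated edge x1x2, and the outer
    columns are joined crosswise, which is the change of twist. *)
Lemma ladder_reduce S e e' x0 x1 x2 x3 y0 y1 y2 y3 :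
  symmetric e -> irreflexive e -> irreflexive e' ->
  uniq [:: x0; x1; x2; x3; y0; y1; y2; y3] ->
  all S [:: x0; x1; x2; x3; y0; y1; y2; y3] -> e x0 y0 ->
  (forall z, S z -> e x1 z = [|| z == x0, z == x2 | z == y1]) ->
  (forall z, S z -> e x2 z = [|| z == x1, z == x3 | z == y2]) ->
  (forall z, S z -> e y1 z = [|| z == y0, z == y2 | z == x1]) ->
  (forall z, S z -> e y2 z = [|| z == y1, z == y3 | z == x2]) ->
  (forall x y, S x -> S y -> x != y1 -> x != y2 -> y != y1 -> y != y2 ->
    e' x y = [|| [&& e x y, ~~ same_pair x0 x1 x y & ~~ same_pair x2 x3 x y],
      same_pair x0 y3 x y | same_pair y0 x3 x y]) ->
  gequiv S e [pred x | [&& S x, x != y1 & x != y2]] e'.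
Proof.
move=> sy irr irr' /=; rewrite !inE !negb_or !andbT => U SS e00 Nx1 Nx2 Ny1 Ny2 ee.
(* These are the 28 disequalities between the eight vertices. *)
move: U; rewrite -!andbA; do 27! (move=> /andP[?]); move=> ?.
move: SS => /and5P[? ? ? ? /and4P[? ? ? ?]].
pose e1 x y := e x y || same_pair x0 y3 x y.
pose e2 x y := e1 x y || same_pair y0 x3 x y.
pose e3 x y := e2 x y && ~~ same_pair x2 x3 x y.
pose e4 x y := e3 x y && ~~ same_pair x0 x1 x y.
have sy1 : symmetric e1 by move=> x y; rewrite /e1 sy same_pairC.
have sy2 : symmetric e2 by move=> x y; rewrite /e2 sy1 same_pairC.
have sy3 : symmetric e3 by move=> x y; rewrite /e3 sy2 same_pairC.
have sy4 : symmetric e4 by move=> x y; rewrite /e4 sy3 same_pairC.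
have irr1 : irreflexive e1 by move=> x; rewrite /e1 irr /same_pair; vertex_cases.
have irr2 : irreflexive e2 by move=> x; rewrite /e2 irr1 /same_pair; vertex_cases.
have irr3 : irreflexive e3 by move=> x; rewrite /e3 irr2.
have irr4 : irreflexive e4 by move=> x; rewrite /e4 irr3.
have eE : ((e x0 y0 = true) * (e y0 x0 = true) * (e x1 x0 = true) * (e x0 x1 = true) *
    (e x1 x2 = true) * (e x2 x1 = true) * (e x2 x3 = true) * (e x3 x2 = true) *
    (e y1 y0 = true) * (e y0 y1 = true) *
    (e y1 y2 = true) * (e y2 y1 = true) * (e y2 y3 = true) * (e y3 y2 = true) *
    (e x1 y1 = true) * (e y1 x1 = true) * (e x2 y2 = true) * (e y2 x2 = true))%type.
  by do !split; rewrite ?e00 // ?Nx1 ?Nx2 ?Ny1 ?Ny2 // ?eqxx ?orbT //;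
    rewrite sy ?Nx1 ?Nx2 ?Ny1 ?Ny2 // ?eqxx ?orbT.
apply: (@gequiv_trans S e1).
  apply: (@add_edge _ _ _ x0 y3 y1) => //; rewrite 1?eq_sym // => z Sz; rewrite Ny1 //.
  by vertex_cases; rewrite ?eE ?orbT.
apply: (@gequiv_trans S e2).
  apply: (@add_edge _ _ _ y0 x3 x1) => //; rewrite 1?eq_sym // => z Sz.
  by rewrite /e1 /same_pair Nx1 //; vertex_cases; rewrite ?eE ?orbT.
apply: (@gequiv_trans S e3).
  apply: gequiv_sym; apply: (@add_edge _ _ _ x2 x3 y1) => //; rewrite 1?eq_sym //.
    move=> z Sz; rewrite /e3 /e2 /e1 Ny1 // /same_pair.
    by vertex_cases; rewrite ?eE ?orbT.
  move=> x y Sx Sy; rewrite /e3 /e2 /e1 /same_pair.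
  by vertex_cases; rewrite ?eE.
apply: (@gequiv_trans S e4).
  apply: gequiv_sym; apply: (@add_edge _ _ _ x0 x1 y2) => //; rewrite 1?eq_sym //.
    move=> z Sz; rewrite /e4 /e3 /e2 /e1 Ny2 // /same_pair.
    by vertex_cases; rewrite ?eE ?orbT.
  move=> x y Sx Sy; rewrite /e4 /e3 /e2 /e1 /same_pair.
  by vertex_cases; rewrite ?eE.
apply: (@gequiv_trans [pred x | S x && (x != y1)] e4).
  apply: (@remove_vertex S e4 y1 x2) => //; rewrite 1?eq_sym //.
  move=> z Sz; rewrite /e4 /e3 /e2 /e1 Nx2 // Ny1 // /same_pair.
  by vertex_cases; rewrite ?eE.
apply: (@gequiv_trans [pred x | [pred x | S x && (x != y1)] x && (x != y2)] e4).
  have Sx1 : [pred x | S x && (x != y1)] x1 by apply/andP.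
  apply: (@remove_vertex _ e4 y2 x1 sy4 irr4 Sx1) => // z /andP[Sz zy];
    rewrite /e4 /e3 /e2 /e1 Nx1 // Ny2 // /same_pair.
  by vertex_cases; rewrite ?eE.
apply: eq_gequiv => // [x|x y /andP[/andP[Sx xy1] xy2] /andP[/andP[Sy yy1] yy2]].
  by rewrite /= andbA.
by rewrite ee // /e4 /e3 /e2 /e1 /same_pair; vertex_cases.
Qed.

End GraphMoves.

(** * Gluing to a complete bipartite graph as suspension *)

Lemma sum_eqE (A B : eqType) :
  ((forall a a' : A, (inl a == inl a' :> A + B) = (a == a')) *
  (forall b b' : B, (inr b == inr b' :> A + B) = (b == b')) *
  (forall a b, (inl a == inr b :> A + B) = false) *
  (forall a b, (inr b == inl a :> A + B) = false))%type.
Proof. by []. Qed.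

Section Suspension.
Context {R : realType} {A H : finType}.
Variables (side : pred A) (f : rel H) (r : A -> H -> bool).
Hypotheses (f_sym : symmetric f) (f_irr : irreflexive f).

Definition glued_adj : rel (A + H)%type := fun u v =>
  match u, v with
  | inl a, inl b => side a != side b
  | inr h, inr g => f h g
  | inl a, inr h | inr h, inl a => r a h
  end.

Definition susp_adj : rel (bool + H)%type := fun u v =>
  match u, v with
  | inl a, inl b => a != b
  | inr h, inr g => f h g
  | _, _ => false
  end.

Let cut (D : pred A) : rel (A + H)%type := fun u v =>
  match u, v with
  | inl a, inr h | inr h, inl a => r a h && ~~ D a
  | _, _ => glued_adj u v
  end.

Let cut_sym D : symmetric (cut D).
Proof. by move=> [a|h] [b|g] //=; rewrite eq_sym. Qed.

Let cut_irr D : irreflexive (cut D).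
Proof. by move=> [a|h] /=; rewrite ?eqxx. Qed.

(** The witness for deleting the edge from a1 to h1 is a2: its neighbours are the opposite side,
    which a1 sees too, and at most h2, which h1 sees. *)
Let cut_edge (D D' : pred A) (a1 a2 : A) (h1 h2 : H) :
  side a1 = side a2 -> r a1 =1 pred1 h1 -> r a2 =1 pred1 h2 -> f h1 h2 ->
  ~~ D a1 -> (D' =1 fun a => D a || (a == a1)) ->
  @gequiv R _ predT (cut D) predT (cut D').
Proof.
move=> s12 r1 r2 f12 Da1 DD; apply: gequiv_sym.
have h21 : h1 != h2 by apply/eqP => h; move: f12; rewrite h f_irr.
have a12 : a2 != a1 by apply/eqP => a; move: (r1 h1) (r2 h1);
  rewrite /= a eqxx => -> /esym/eqP/eqP; rewrite (negbTE h21).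
apply: (@add_edge _ _ _ _ _ (inl a1) (inr h1) (inl a2)) => //.
  move=> [b|g] _ /=; first by rewrite s12 => ->.
  by rewrite r2 /= => /andP[/eqP -> _]; rewrite f12 orbT.
move=> [a|h] [b|g] _ _; rewrite /same_pair /= !sum_eqE ?(orbF, andbF) //.
- rewrite DD negb_or andbA; have [->|_] := eqVneq a a1; last by rewrite !andbT !orbF.
  by rewrite r1 Da1 /= andbT andbF.
- rewrite DD negb_or andbA; have [->|_] := eqVneq b a1;
    last by rewrite !andbT !andbF orbF.
  by rewrite r1 Da1 /= !andbT andbF.
Qed.

(** Two vertices on each side, attached to adjacent vertices of [H], suffice: one of each pair is
    detached from [H] and then absorbs its whole side. The edge a1b1 that survives is disjoint from
    [H]. *)
Lemma glued_suspension a1 a2 b1 b2 h1 h2 g1 g2 :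
  side a1 -> side a2 -> ~~ side b1 -> ~~ side b2 ->
  r a1 =1 pred1 h1 -> r a2 =1 pred1 h2 -> f h1 h2 ->
  r b1 =1 pred1 g1 -> r b2 =1 pred1 g2 -> f g1 g2 ->
  @homotopy_equivalent R (flag R (fun u v => ~~ glued_adj u v))
    (flag R (ind predT susp_adj)).
Proof.
move=> sa1 sa2 sb1 sb2 ra1 ra2 f12 rb1 rb2 g12.
have ab : b1 != a1 by apply: contraNneq sb1 => ->.
pose D1 : pred A := pred1 a1; pose D2 : pred A := fun a => (a == a1) || (a == b1).
have q1 : @gequiv R _ predT (cut pred0) predT (cut D1).
  by apply: cut_edge ra1 ra2 f12 _ _ => //; rewrite sa1 sa2.
have q2 : @gequiv R _ predT (cut D1) predT (cut D2).
  by apply: cut_edge rb1 rb2 g12 _ _ => //; rewrite (negbTE sb1) (negbTE sb2).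
pose Ea (u : A + H) := if u is inl a then side a && (a != a1) else false.
pose Eb (u : A + H) := if u is inl a then ~~ side a && (a != b1) else false.
(* Detached from [H], the vertex a1 sees only the opposite side, and so does every vertex of its own
   side; all of these can go. The same happens at b1 in [q4]. *)
have q3 : @gequiv R _ predT (cut D2) [pred x | predT x && ~~ Ea x] (cut D2).
  apply: (@remove_vertices _ _ _ _ _ (inl a1)) => //=; first by rewrite eqxx andbF.
  move=> [a|//] [b|h] //=; first by case/andP => -> _ _; rewrite sa1.
  by move=> _ _; rewrite /D2 eqxx andbF.
have q4 : @gequiv R _ [pred x | predT x && ~~ Ea x] (cut D2)
    [pred x | [pred x | predT x && ~~ Ea x] x && ~~ Eb x] (cut D2).
  apply: (@remove_vertices _ _ _ _ _ (inl b1)) => //=;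
    rewrite ?eqxx ?(negbTE sb1) ?andbF //.
  move=> [b|//] [a|h] //=; first by case/andP => /negbTE -> _ _.
  by move=> _ _; rewrite /D2 eqxx orbT andbF.
apply: (@heq_trans _ (flag R (ind predT (cut pred0)))).
  rewrite /flag (@eq_flag_set _ _ _ (ind predT (cut pred0))); first exact: heq_refl.
    by move=> [a|h] [b|g] _ _; rewrite /ind /= ?andbT.
  by move=> [a|h]; rewrite /ind /= ?eqxx.
apply: heq_trans q1 _; apply: heq_trans q2 _; apply: heq_trans q3 _.
apply: heq_trans q4 _; apply: heq_sym.
pose phi (u : bool + H) : A + H :=
  match u with inl b => inl (if b then a1 else b1) | inr h => inr h end.
have phi_inj : injective phi.
  move=> [[]|h] [[]|g] //= []; try by [move=> ->].
    by move=> e; rewrite e eqxx in ab.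
  by move=> e; rewrite e eqxx in ab.
apply: (heq_trans _ (flag_transfer (f := phi) phi_inj _)); last first.
  move=> [a|h]; last by exists (inr h).
  rewrite /ind /= => /and3P[/andP[+ +] _ _].
  case: (boolP (side a)) => sa /= ha hb.
    by exists (inl true); move/negPn/eqP: ha => ->.
  by exists (inl false); move/negPn/eqP: hb => ->.
rewrite /flag (@eq_flag_set _ _ _ (fun a b =>
  ind [pred x | [pred x | predT x && ~~ Ea x] x && ~~ Eb x] (cut D2) (phi a) (phi b))).
- exact: heq_refl.
- move=> [[]|h] [[]|g] _ _; rewrite /ind /= /D2 ?eqxx ?sa1 ?(negbTE sb1) //= ?andbF
    ?andbT ?orbT ?andbF //.
- by move=> [[]|h]; rewrite /ind /= ?eqxx ?f_irr.
Qed.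

End Suspension.

(** * Cycles *)

Section Cycles.
Context {R : realType}.
Variable m : nat.

(* After reduction of an m-cycle to an M-cycle on the vertices i < M, where
   M = m mod 3, the vertices M + 3t and M + 3t + 1 carry isolated edges and the
   vertices M + 3t + 2 are absent. *)
Definition tail3 (i : nat) : bool := (i %% 3 == m %% 3)%N.

Definition cycle_half (M i j : nat) : bool :=
  [|| (j == i.+1) && (j < M), [&& i == 0, j.+1 == M & 1 < M]
    | [&& M <= i, tail3 i & j == i.+1]]%N.

Definition cycle_vertex (M : nat) (u : bool + 'I_m) : bool :=
  match u with inl _ => true | inr i => (i < M)%N || ~~ tail3 i.+1 end.

Definition cycle_adj (M : nat) : rel (bool + 'I_m)%type :=
  susp_adj (fun i j : 'I_m => cycle_half M i j || cycle_half M j i).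

Lemma cycle_adj_sym M : symmetric (cycle_adj M).
Proof. by move=> [a|i] [b|j] //=; rewrite ?(eq_sym a) // orbC. Qed.

Lemma cycle_adj_irr M : irreflexive (cycle_adj M).
Proof. move=> [a|i] /=; rewrite ?eqxx // /cycle_half orbb; lia. Qed.

Let vertex_eqE :
  ((forall i j : 'I_m, (inr i == inr j :> (bool + 'I_m)%type) = (i == j :> nat)) *
  (forall a (j : 'I_m), (inl a == inr j :> (bool + 'I_m)%type) = false) *
  (forall a (j : 'I_m), (inr j == inl a :> (bool + 'I_m)%type) = false))%type.
Proof. by []. Qed.

Let tail3E M i : (M %% 3 = m %% 3)%N -> (M <= i < M.+3)%N ==> (tail3 i == (i == M)).
Proof. rewrite /tail3; lia. Qed.

Let tail3SE M i : (M %% 3 = m %% 3)%N -> (M <= i < M.+3)%N ==> (tail3 i.+1 == (i ==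
  M.+2)).
Proof. rewrite /tail3; lia. Qed.

Let cycle_half_step M i j : (1 < M)%N -> (M %% 3 = m %% 3)%N -> i != M.+2 -> j != M.+2
  ->
  cycle_half M i j =
  (cycle_half M.+3 i j && ~~ ((i == M.-1) && (j == M))) || (i == 0)%N && (j == M.-1).
Proof.
move=> M1 Mm iM jM; have := tail3E i Mm; rewrite /cycle_half; move: (tail3 i) => a a0.
apply/idP/idP.
  by move=> /or3P[/andP[h1 h2]|/and3P[h1 h2 h3]|/and3P[h1 h2 h3]]; lia.
by move=> /orP[/andP[/or3P[/andP[h1 h2]|/and3P[h1 h2 h3]|/and3P[h1 h2 h3]] h]|/andP[h1
  h2]]; lia.
Qed.

(** The edge deleted in [cycle_half_step] is listed in one orientation only. Excluding the other
    reduces the symmetrised statement [cycle_adj_step] to propositional logic. *)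
Let cycle_halfN M i j : (1 < M)%N -> cycle_half M.+3 i j -> ~~ ((j == M.-1) && (i ==
  M)).
Proof.
by move=> M1; rewrite /cycle_half => /or3P[/andP[h1 h2]|/and3P[h1 h2 h3]|/and3P[h1 h2
  h3]]; lia.
Qed.

Let cycle_adj_step M i j : (1 < M)%N -> (M %% 3 = m %% 3)%N -> i != M.+2 -> j != M.+2 ->
  cycle_half M i j || cycle_half M j i =
  (cycle_half M.+3 i j || cycle_half M.+3 j i) &&
    ~~ ((i == M) && (j == M.-1) || (i == M.-1) && (j == M)) ||
    ((i == M.-1) && (j == 0)%N || (i == 0)%N && (j == M.-1)).
Proof.
move=> M1 Mm iM jM; rewrite (@cycle_half_step M i j) // (@cycle_half_step M j i) //.
have /implyP := @cycle_halfN M i j M1; have /implyP := @cycle_halfN M j i M1.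
rewrite (andbC (j == M.-1) (i == M)) (andbC (j == 0)%N (i == M.-1)).
move: (cycle_half _ i j) (cycle_half _ j i) (_ && (j == M)) (_ && (j == 0)%N) => a b c
  d.
move: (_ && (j == M.-1)) => f; move: (_ && (j == M.-1)) => g.
by move: a b c d f g; do 6! case.
Qed.

Let cycle_nbr M k : (1 < M)%N ->
  cycle_half M.+3 M k || cycle_half M.+3 k M = (k == M.-1) || (k == M.+1).
Proof.
move=> M1; rewrite /cycle_half; move: (tail3 _) (tail3 _) => a b; apply/idP/idP.
  by move=> /orP[]/or3P[/andP[h1 h2]|/and3P[h1 h2 h3]|/and3P[h1 h2 h3]]; lia.
by move=> /orP[/eqP ->|/eqP ->]; lia.
Qed.

Let cycle_nbr1 M k : (1 < M)%N ->
  cycle_half M.+3 M.+1 k || cycle_half M.+3 k M.+1 = (k == M) || (k == M.+2).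
Proof.
move=> M1; rewrite /cycle_half; move: (tail3 _) (tail3 _) => a b; apply/idP/idP.
  by move=> /orP[]/or3P[/andP[h1 h2]|/and3P[h1 h2 h3]|/and3P[h1 h2 h3]]; lia.
by move=> /orP[/eqP ->|/eqP ->]; lia.
Qed.

Let cycle_nbr2 M k : (1 < M)%N ->
  cycle_half M.+3 M.+2 k || cycle_half M.+3 k M.+2 = (k == M.+1) || (k == 0)%N.
Proof.
move=> M1; rewrite /cycle_half; move: (tail3 _) (tail3 _) => a b; apply/idP/idP.
  by move=> /orP[]/or3P[/andP[h1 h2]|/and3P[h1 h2 h3]|/and3P[h1 h2 h3]]; lia.
by move=> /orP[/eqP ->|/eqP ->]; lia.
Qed.

(** This is [path_reduce] along M-1, M, M+1, M+2, 0; the bound [1 < M] keeps the two ends of the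
    path distinct. *)
Lemma cycle_step M : (M.+3 <= m)%N -> (1 < M)%N -> (M %% 3 = m %% 3)%N ->
  @gequiv R _ (cycle_vertex M.+3) (cycle_adj M.+3) (cycle_vertex M) (cycle_adj M).
Proof.
move=> Mm M1 M3.
have ha : (M < m)%N by lia.
have hb : (M.+1 < m)%N by lia.
have hc : (M.+2 < m)%N by lia.
have hp : (M.-1 < m)%N by lia.
have hq : (0 < m)%N by lia.
pose o k h : (bool + 'I_m)%type := inr (@Ordinal m k h).
apply: (gequiv_trans (@path_reduce _ _ _ _ (cycle_adj M) (o _ hp) (o _ ha) (o _ hb)
  (o _ hc) (o _ hq) _ _ _ _ _ _ _ _ _)).
- exact: cycle_adj_sym.
- exact: cycle_adj_irr.
- exact: cycle_adj_irr.
- rewrite /= !inE /o ?vertex_eqE /=; lia.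
- rewrite /=; lia.
- by move=> [a|i] // Si; rewrite /o ?vertex_eqE /=; exact: cycle_nbr.
- by move=> [a|i] // Si; rewrite /o ?vertex_eqE /=; exact: cycle_nbr1.
- by move=> [a|i] // Si; rewrite /o ?vertex_eqE /=; exact: cycle_nbr2.
- move=> [a|i] [b|j]; rewrite /same_pair /= /o ?vertex_eqE //= ?(andbF, andbT, orbF) //.
  move=> Si Sj iM jM; exact: cycle_adj_step.
apply: eq_gequiv => //; try exact: cycle_adj_irr.
move=> [a|i] /=; rewrite /o ?vertex_eqE //=; have := tail3SE i M3;
  move: (tail3 _) => b; lia.
Qed.

Lemma cycle_steps M t : m = (M + 3 * t)%N -> (1 < M)%N ->
  @gequiv R _ (cycle_vertex m) (cycle_adj m) (cycle_vertex M) (cycle_adj M).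
Proof.
move=> mE M1.
have h s : (s <= t)%N -> @gequiv R _ (cycle_vertex m) (cycle_adj m)
    (cycle_vertex (m - 3 * s)) (cycle_adj (m - 3 * s)).
  elim: s => [_|s IH st].
    by rewrite muln0 subn0; apply: eq_gequiv => //; exact: cycle_adj_irr.
  apply: gequiv_trans (IH (ltnW st)) _.
  rewrite (_ : (m - 3 * s)%N = (m - 3 * s.+1).+3); last by lia.
  apply: cycle_step; lia.
by have := h t (leqnn t); rewrite (_ : (m - 3 * t)%N = M); last by lia.
Qed.

Lemma cross_gequiv (V : finType) (S : pred V) (e : rel V) r' d
    (f : option 'I_r'.+1 + 'I_d * bool -> V) :
  injective f -> (forall v, S v -> exists w, f w = v) -> (forall w, S (f w)) ->
  (forall u w, e (f u) (f w) = cross_adj u w) ->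
  homotopy_equivalent R (flag R (ind S e)) (flag R (@cross r' d)).
Proof.
move=> f_inj f_surj Sf ef; apply: heq_sym.
apply: (heq_trans _ (flag_transfer (f := f) f_inj _)); last first.
  by move=> v /and3P[Sv _ _]; exact: f_surj.
rewrite /flag (@eq_flag_set _ _ _ (fun a b => ind S e (f a) (f b))).
- exact: heq_refl.
- by move=> u v _ _; rewrite /ind !Sf ef.
- by move=> u; rewrite /ind !Sf ef.
Qed.

(** The core is complete on the vertices below [r'.+2]; allowing [r'.+2 < M] covers the folded
    4-cycle. In [cross], pair 0 is the suspension edge and pair k+1 the k-th isolated edge, hence
    [t.+1] pairs. *)
Lemma cycle_reduced_cross (M t r' : nat) (S : pred (bool + 'I_m)) (e : rel (bool +
  'I_m)) :
  m = (M + 3 * t)%N -> (r'.+2 <= M)%N -> symmetric e ->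
  (forall b, S (inl b)) -> (forall b c, e (inl b) (inl c) = (b != c)) ->
  (forall b i, e (inl b) (inr i) = false) ->
  (forall i, S (inr i) = (i < r'.+2)%N || (M <= i)%N && ~~ tail3 i.+1) ->
  (forall i j, S (inr i) -> S (inr j) -> e (inr i) (inr j) =
    [|| [&& i < r'.+2, j < r'.+2 & i != j], [&& M <= i, tail3 i & j == i.+1 :> nat]
      | [&& M <= j, tail3 j & i == j.+1 :> nat]]%N) ->
  homotopy_equivalent R (flag R (ind S e)) (flag R (@cross r' t.+1)).
Proof.
move=> mE hM sy Sl ell elr Sr er.
have m0 : (0 < m)%N by lia.
pose u0 := Ordinal m0.
pose hd (o : option 'I_r'.+1) : nat := if o is Some k then k.+1 else 0.
pose tl (k : nat) (b : bool) : nat := (M + 3 * k + b)%N.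
pose f (u : option 'I_r'.+1 + 'I_t.+1 * bool) : bool + 'I_m :=
  match u with
  | inl o => inr (insubd u0 (hd o))
  | inr (k, b) => if val k is k'.+1 then inr (insubd u0 (tl k' b)) else inl b
  end.
have hd_lt o : (hd o < r'.+2)%N by case: o => [k|] //=; rewrite ltnS.
have hdE o : insubd u0 (hd o) = hd o :> nat.
  by rewrite val_insubd ifT //; have := hd_lt o; lia.
have tlE k b : (k < t)%N -> insubd u0 (tl k b) = tl k b :> nat.
  by move=> kt; rewrite val_insubd ifT // /tl; case: b; lia.
have hd_inj : injective hd.
  by move=> [k|] [k'|] //= [] /ord_inj ->.
have fS w : S (f w).
  case: w => [o|[[[|k] /= kt] b]] //=; rewrite Sr.
    by rewrite hdE hd_lt.
  rewrite tlE // /tl /tail3; case: b; lia.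
have tail_tl k : tail3 (tl k false) by rewrite /tail3 /tl; lia.
have tail_tl' k : tail3 (tl k true) = false by rewrite /tail3 /tl; lia.
have hd_tl o k b : (hd o == tl k b) = false.
  by have := hd_lt o; rewrite /tl; case: b; lia.
apply: (cross_gequiv (f := f)) => //.
- move=> [o|[[[|k] /= kt] b]] [o'|[[[|k'] /= kt'] b']] //=.
  + by move=> [/(congr1 (@nat_of_ord m))]; rewrite !hdE => /hd_inj ->.
  + by move=> [/(congr1 (@nat_of_ord m))]; rewrite hdE tlE // => /eqP; rewrite hd_tl.
  + by move=> [->]; congr (inr (_, _)); apply: val_inj.
  + by move=> [/(congr1 (@nat_of_ord m))]; rewrite hdE tlE // => /esym/eqP;
      rewrite hd_tl.
  + move=> [/(congr1 (@nat_of_ord m))]; rewrite !tlE // /tl => h.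
    have -> : b = b' by move: h; case: b; case: b' => //; lia.
    by congr (inr (_, _)); apply: val_inj => /=; move: h; case: b; case: b'; lia.
- move=> [b _|i]; first by exists (inr (ord0, b)).
  rewrite Sr; have [ih _|ih /=] := ltnP i r'.+2.
    case: i ih => [[|k] im] /= ih.
      by exists (inl None); rewrite /f; congr inr; apply: ord_inj; rewrite hdE.
    have kr : (k < r'.+1)%N by lia.
    by exists (inl (Some (Ordinal kr))); rewrite /f; congr inr; apply: ord_inj;
      rewrite hdE.
  move=> /andP[Mi it]; have im := ltn_ord i.
  (* The quotient of i - M by 3 numbers the isolated edge and the remainder, 0 or 1, tells its ends
     apart; remainder 2 is excluded by [it]. *)
  have kt : (((i - M) %/ 3).+1 < t.+1)%N by lia.
  exists (inr (Ordinal kt, ((i - M) %% 3 == 1)%N)); rewrite /f /=; congr inr;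
    apply: ord_inj.
  rewrite tlE // /tl; move: it; rewrite /tail3; case: eqP => /=; lia.
- move=> [o|[[[|k] /= kt] b]] [o'|[[[|k'] /= kt'] b']] //=; rewrite ?ell //.
  + have := fS (inl o); have := fS (inl o'); rewrite /= => So' So;
      rewrite er // !hdE !hd_lt /=.
    rewrite -(inj_eq hd_inj) -val_eqE /= !hdE; have := hd_lt o; have := hd_lt o'; lia.
  + by rewrite sy elr.
  + have := fS (inl o); have := fS (inr (Ordinal kt', b')); rewrite /= => So' So.
    rewrite er // -val_eqE /= !hdE !tlE //; have := hd_lt o; rewrite /tl;
      case: b' {So'}; lia.
  + have := fS (inl o'); have := fS (inr (Ordinal kt, b)); rewrite /= => So So'.
    rewrite er // -val_eqE /= !hdE !tlE //; have := hd_lt o'; rewrite /tl;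
      case: b {So}; lia.
  + by rewrite sy elr.
  + have := fS (inr (Ordinal kt, b)); have := fS (inr (Ordinal kt', b'));
      rewrite /= => So' So.
    rewrite er // -!val_eqE /= !tlE //; case: b {So}; case: b' {So'};
      rewrite ?tail_tl ?tail_tl' /tl /=; lia.
Qed.

Let full_cycle M t : m = (M + 3 * t)%N -> (1 < M)%N ->
  @gequiv R _ predT (cycle_adj m) (cycle_vertex M) (cycle_adj M).
Proof.
move=> mE M1; apply: gequiv_trans (cycle_steps mE M1).
apply: eq_gequiv => //; try exact: cycle_adj_irr.
by move=> [b|i] //=; rewrite ltn_ord.
Qed.

(** The degenerate 2-cycle at the end of the reduction is a single edge, that is, $K_2$. *)
Lemma cycle_cross2 t : m = (2 + 3 * t)%N ->
  homotopy_equivalent R (flag R (ind predT (cycle_adj m))) (flag R (@cross 0 t.+1)).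
Proof.
move=> mE; apply: heq_trans (full_cycle mE isT) _.
apply: (cycle_reduced_cross (M := 2)) => // [|i|i j].
- exact: cycle_adj_sym.
- by rewrite /= (leqNgt 2) orb_andr orbN andTb.
- rewrite /= -(inj_eq (@ord_inj m)) /cycle_half;
    move: (nat_of_ord i) (nat_of_ord j) (tail3 _) (tail3 _) (tail3 _) (tail3 _) => /=
      x y a b c d Si Sj; lia.
Qed.

Lemma cycle_cross3 t : m = (3 + 3 * t)%N ->
  homotopy_equivalent R (flag R (ind predT (cycle_adj m))) (flag R (@cross 1 t.+1)).
Proof.
move=> mE; apply: heq_trans (full_cycle mE isT) _.
apply: (cycle_reduced_cross (M := 3)) => // [|i|i j].
- exact: cycle_adj_sym.
- by rewrite /= (leqNgt 3) orb_andr orbN andTb.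
- rewrite /= -(inj_eq (@ord_inj m)) /cycle_half;
    move: (nat_of_ord i) (nat_of_ord j) (tail3 _) (tail3 _) (tail3 _) (tail3 _) => /=
      x y a b c d Si Sj; lia.
Qed.

(** For residue 1 the steps stop at length 4. Opposite vertices of a 4-cycle have the same
    neighbours, so 1 dominates 3, then 0 dominates 2, and the edge 01 remains. *)
Lemma cycle_cross4 t : m = (4 + 3 * t)%N ->
  homotopy_equivalent R (flag R (ind predT (cycle_adj m))) (flag R (@cross 0 t.+1)).
Proof.
move=> mE; apply: heq_trans (full_cycle mE isT) _.
have [h0 h1 h2 h3] : [/\ 0 < m, 1 < m, 2 < m & 3 < m]%N by split; lia.
pose o k h : bool + 'I_m := inr (@Ordinal m k h).
apply: (@heq_trans _ (flag R (ind [pred x | cycle_vertex 4 x && (x != o _ h3)]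
  (cycle_adj 4)))).
  apply: (@remove_vertex _ _ _ _ _ (o _ h1)) => //.
  - exact: cycle_adj_sym.
  - exact: cycle_adj_irr.
  - move=> [b|i] //=; rewrite /cycle_half; lia.
apply: (@heq_trans _ (flag R (ind [pred x | [pred x | cycle_vertex 4 x && (x != o _
  h3)] x &&
    (x != o _ h2)] (cycle_adj 4)))).
  apply: (@remove_vertex _ _ _ _ _ (o _ h0)) => //.
  - exact: cycle_adj_sym.
  - exact: cycle_adj_irr.
  - move=> [b|i] //=; rewrite /o !vertex_eqE /cycle_half /=.
    lia.
apply: (cycle_reduced_cross (M := 4)) => // [|i|i j].
- exact: cycle_adj_sym.
- rewrite /= /o !vertex_eqE /=; lia.
- rewrite /= /o !vertex_eqE -(inj_eq (@ord_inj m)) /cycle_half /=.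
  move=> Si Sj.
  apply/idP/idP => ?; lia.
Qed.

End Cycles.

(** * Ladders *)

Section Ladders.
Context {R : realType}.
Variable m : nat.

Definition tail2 (i : nat) : bool := (i %% 2 == m %% 2)%N.

(* The ladder of M columns (i, false), (i, true) for i < M, closed up with a
   twist if ep; beyond it, the vertices (M + 2t, false) and (M + 2t + 1, false)
   carry isolated edges and the vertices (i, true) are absent. *)
Definition ladder_half (M : nat) (ep : bool) (i : nat) (b : bool) (j : nat) (c : bool)
  : bool :=
  [|| [&& i == j, i < M, ~~ b & c], [&& j == i.+1, j < M & b == c],
    [&& i == 0, j.+1 == M, 1 < M & c == b (+) ep]
    | [&& M <= i, tail2 i, j == i.+1, ~~ b & ~~ c]]%N.

Definition ladder_vertex (M : nat) (u : bool + 'I_m * bool) : bool :=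
  match u with inl _ => true | inr (i, b) => (i < M)%N || ~~ b end.

Definition ladder_adj (M : nat) (ep : bool) : rel (bool + 'I_m * bool)%type :=
  susp_adj (fun u v : 'I_m * bool => ladder_half M ep u.1 u.2 v.1 v.2 ||
    ladder_half M ep v.1 v.2 u.1 u.2).

Lemma ladder_adj_sym M ep : symmetric (ladder_adj M ep).
Proof. by move=> [a|i] [b|j] //=; rewrite ?(eq_sym a) // orbC. Qed.

Lemma ladder_adj_irr M ep : irreflexive (ladder_adj M ep).
Proof.
move=> [a|[i b]] /=; rewrite ?eqxx // /ladder_half orbb.
case: b; case: ep => /=; lia.
Qed.

Let vertex_eqE :
  ((forall (i j : 'I_m) (b c : bool), (inr (i, b) == inr (j, c) :> (bool + 'I_m *
    bool)%type) =
    (i == j :> nat) && (b == c)) *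
  (forall a (j : 'I_m * bool), (inl a == inr j :> (bool + 'I_m * bool)%type) = false) *
  (forall a (j : 'I_m * bool), (inr j == inl a :> (bool + 'I_m * bool)%type) =
    false))%type.
Proof. by []. Qed.

Let tail2E M i : (M %% 2 = m %% 2)%N -> (M <= i < M.+2)%N ==> (tail2 i == (i == M)).
Proof. rewrite /tail2; lia. Qed.

(** The edges (M-1, false)(M, false) and (M+1, false)(0, ep) disappear. The new ones, (M-1,
    false)(0, ~~ ep) and (M-1, true)(0, ep), form the closing of M columns with the opposite
    twist. *)
Let ladder_half_step M ep i b j c : (1 < M)%N -> (M %% 2 = m %% 2)%N ->
  ~~ (b && ((i == M) || (i == M.+1))) -> ~~ (c && ((j == M) || (j == M.+1))) ->
  ladder_half M (~~ ep) i b j c =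
  [|| [&& ladder_half M.+2 ep i b j c, ~~ [&& i == M.-1, ~~ b, j == M & ~~ c]
      & ~~ [&& i == 0%N, b == ep, j == M.+1 & ~~ c]],
    [&& i == 0%N, b == ~~ ep, j == M.-1 & ~~ c]
    | [&& i == 0%N, b == ep, j == M.-1 & c]].
Proof.
move=> M1 Mm; have := tail2E i Mm; rewrite /ladder_half; move: (tail2 i) => a.
case: b; case: c; case: ep; rewrite /= ?(andbF, andbT, orbF) => a0 Si Sj;
  apply/idP/idP => ?; lia.
Qed.

Let ladder_halfN M ep i b j c : (1 < M)%N -> ladder_half M.+2 ep i b j c ->
  ~~ [&& j == M.-1, ~~ c, i == M & ~~ b] && ~~ [&& j == 0%N, c == ep, i == M.+1 & ~~ b].
Proof.
move=> M1; rewrite /ladder_half; case: b; case: c; case: ep;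
  rewrite /= ?(andbF, andbT, orbF) => ?; lia.
Qed.

Let ladder_adj_step M ep i b j c : (1 < M)%N -> (M %% 2 = m %% 2)%N ->
  ~~ (b && ((i == M) || (i == M.+1))) -> ~~ (c && ((j == M) || (j == M.+1))) ->
  ladder_half M (~~ ep) i b j c || ladder_half M (~~ ep) j c i b =
  [|| [&& ladder_half M.+2 ep i b j c || ladder_half M.+2 ep j c i b,
      ~~ ([&& i == M.-1, ~~ b, j == M & ~~ c] || [&& j == M.-1, ~~ c, i == M & ~~ b])
      & ~~ ([&& j == 0%N, c == ep, i == M.+1 & ~~ b] || [&& i == 0%N, b == ep, j ==
        M.+1 & ~~ c])],
    [&& j == 0%N, c == ~~ ep, i == M.-1 & ~~ b] || [&& i == 0%N, b == ~~ ep, j == M.-1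
      & ~~ c]
    | [&& j == 0%N, c == ep, i == M.-1 & b] || [&& i == 0%N, b == ep, j == M.-1 & c]].
Proof.
move=> M1 Mm Si Sj; rewrite (@ladder_half_step M ep i b j c) // (@ladder_half_step M
  ep j c i b) //.
have /implyP := @ladder_halfN M ep i b j c M1;
  have /implyP := @ladder_halfN M ep j c i b M1.
move: (ladder_half _ _ i b j c) (ladder_half _ _ j c i b) => h h'.
move: [&& i == M.-1, ~~ b, j == M & ~~ c] [&& j == M.-1, ~~ c, i == M & ~~ b] => p p'.
move: [&& i == 0%N, b == ep, j == M.+1 & ~~ c] [&& j == 0%N, c == ep, i == M.+1 & ~~
  b] => q q'.
move: [&& j == 0%N, c == ~~ ep, i == M.-1 & ~~ b] [&& i == 0%N, b == ~~ ep, j == M.-1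
  & ~~ c] => s s'.
move: [&& j == 0%N, c == ep, i == M.-1 & b] [&& i == 0%N, b == ep, j == M.-1 & c] => t
  t'.
by move: h h' p p' q q' s s' t t'; do 10! case.
Qed.

Lemma ladder_step M ep : (M.+2 <= m)%N -> (1 < M)%N -> (M %% 2 = m %% 2)%N ->
  @gequiv R _ (ladder_vertex M.+2) (ladder_adj M.+2 ep) (ladder_vertex M) (ladder_adj
    M (~~ ep)).
Proof.
move=> Mm M1 M2.
have h1 : (M < m)%N by lia.
have h2 : (M.+1 < m)%N by lia.
have h0 : (M.-1 < m)%N by lia.
have h3 : (0 < m)%N by lia.
pose o k h b : (bool + 'I_m * bool)%type := inr (@Ordinal m k h, b).
(* The closing of the longer ladder joins (M+1, false) to (0, ep) and (M+1, true) to (0, ~~ ep), so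
   these serve as x3 and y3. *)
apply: (gequiv_trans (@ladder_reduce _ _ _ _ (ladder_adj M (~~ ep))
  (o _ h0 false) (o _ h1 false) (o _ h2 false) (o _ h3 ep)
  (o _ h0 true) (o _ h1 true) (o _ h2 true) (o _ h3 (~~ ep)) _ _ _ _ _ _ _ _ _ _ _)).
- exact: ladder_adj_sym.
- exact: ladder_adj_irr.
- exact: ladder_adj_irr.
- rewrite /= !inE /o ?vertex_eqE /=; case: ep => /=; lia.
- rewrite /=; case: ep; lia.
- rewrite /= /ladder_half /=; lia.
- move=> [a|[k b]] // Sk; rewrite /o ?vertex_eqE /= /ladder_half; case: b {Sk};
    case: ep;
    rewrite /= ?(andbF, andbT, orbF); apply/idP/idP => ?; lia.
- move=> [a|[k b]] // Sk; rewrite /o ?vertex_eqE /= /ladder_half; case: b {Sk};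
    case: ep;
    rewrite /= ?(andbF, andbT, orbF); apply/idP/idP => ?; lia.
- move=> [a|[k b]] // Sk; rewrite /o ?vertex_eqE /= /ladder_half; case: b Sk;
    case: ep => /= Sk;
    rewrite /= ?(andbF, andbT, orbF); apply/idP/idP => ?; lia.
- move=> [a|[k b]] // Sk; rewrite /o ?vertex_eqE /= /ladder_half; case: b Sk;
    case: ep => /= Sk;
    rewrite /= ?(andbF, andbT, orbF); apply/idP/idP => ?; lia.
- move=> [a|[i b]] [a'|[j c]]; rewrite /same_pair /= /o ?vertex_eqE //= ?(andbF,
    andbT, orbF) //.
  move=> Si Sj; rewrite !eqbF_neg !eqb_id => n1 n2 n3 n4; rewrite -!andbA.
  have and4C (x y z w : bool) : [&& x, y, z & w] = [&& z, w, x & y].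
    by case: x; case: y; case: z; case: w.
  rewrite (and4C (i == M :> nat)) (and4C (i == M.+1 :> nat)).
  rewrite (and4C (i == M.-1 :> nat) (~~ b) (j == 0 :> nat)%N).
  rewrite (and4C (i == M.-1 :> nat) b (j == 0 :> nat)%N).
  apply: ladder_adj_step => //; rewrite andbC negb_and.
    by move: n1 n2; case: b {Si} => //=; rewrite ?andbT ?orbF ?orbT // negb_or => -> ->.
  by move: n3 n4; case: c {Sj} => //=; rewrite ?andbT ?orbF ?orbT // negb_or => -> ->.
apply: eq_gequiv => //; try exact: ladder_adj_irr.
move=> [a|[i b]] /=; rewrite /o ?vertex_eqE //=; case: b => /=; lia.
Qed.

Lemma ladder_steps ep t : m = (2 + 2 * t)%N ->
  @gequiv R _ (ladder_vertex m) (ladder_adj m ep) (ladder_vertex 2) (ladder_adj 2 (ep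
    (+) odd t)).
Proof.
move=> mE.
have h s : (s <= t)%N -> @gequiv R _ (ladder_vertex m) (ladder_adj m ep)
    (ladder_vertex (m - 2 * s)) (ladder_adj (m - 2 * s) (ep (+) odd s)).
  elim: s => [_|s IH st].
    by rewrite muln0 subn0 addbF; apply: eq_gequiv => //; exact: ladder_adj_irr.
  apply: gequiv_trans (IH (ltnW st)) _.
  rewrite (_ : (m - 2 * s)%N = (m - 2 * s.+1).+2); last by lia.
  rewrite /= addbN; apply: ladder_step; lia.
by have := h t (leqnn t); rewrite (_ : (m - 2 * t)%N = 2); last by lia.
Qed.

(* The remaining complete part consists of the first r'.+2 vertices in the order
   (0, false), (0, true), (1, false), (1, true). *)
Lemma ladder_reduced_cross (t r' : nat) (S : pred (bool + 'I_m * bool))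
    (e : rel (bool + 'I_m * bool)) :
  m = (2 + 2 * t)%N -> (r'.+2 <= 4)%N -> symmetric e ->
  (forall b, S (inl b)) -> (forall b c, e (inl b) (inl c) = (b != c)) ->
  (forall b v, e (inl b) (inr v) = false) ->
  (forall i b, S (inr (i, b)) = (2 * i + b < r'.+2)%N || (2 <= i)%N && ~~ b) ->
  (forall i b j c, S (inr (i, b)) -> S (inr (j, c)) -> e (inr (i, b)) (inr (j, c)) =
    [|| [&& 2 * i + b < r'.+2, 2 * j + c < r'.+2 & 2 * i + b != 2 * j + c],
      [&& 2 <= i, tail2 i & j == i.+1 :> nat]
      | [&& 2 <= j, tail2 j & i == j.+1 :> nat]]%N) ->
  homotopy_equivalent R (flag R (ind S e)) (flag R (@cross r' t.+1)).
Proof.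
move=> mE hM sy Sl ell elr Sr er.
have m0 : (0 < m)%N by lia.
pose u0 := Ordinal m0.
pose hd (o : option 'I_r'.+1) : nat := if o is Some k then k.+1 else 0.
pose tl (k : nat) (b : bool) : nat := (2 + 2 * k + b)%N.
(* [hd o] is the number 2i + b of the vertex (i, b), so halving and parity recover column and row.
   As for cycles, pair 0 is the suspension edge. *)
pose f (u : option 'I_r'.+1 + 'I_t.+1 * bool) : bool + 'I_m * bool :=
  match u with
  | inl o => inr (insubd u0 (hd o)./2, odd (hd o))
  | inr (k, b) => if val k is k'.+1 then inr (insubd u0 (tl k' b), false) else inl b
  end.
have hd_lt o : (hd o < r'.+2)%N by case: o => [k|] //=; rewrite ltnS.
have hdE o : insubd u0 (hd o)./2 = (hd o)./2 :> nat.
  by rewrite val_insubd ifT //; have := hd_lt o; lia.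
have hdE' o : (2 * insubd u0 (hd o)./2 + odd (hd o))%N = hd o.
  by rewrite hdE mul2n addnC odd_double_half.
have tlE k b : (k < t)%N -> insubd u0 (tl k b) = tl k b :> nat.
  by move=> kt; rewrite val_insubd ifT // /tl; case: b; lia.
have hd_inj : injective hd by move=> [k|] [k'|] //= [] /ord_inj ->.
have fS w : S (f w).
  case: w => [o|[[[|k] /= kt] b]] //=; rewrite Sr; first by rewrite hdE' hd_lt.
  by rewrite tlE // /tl; lia.
have tail_tl k b : tail2 (tl k b) = ~~ b by rewrite /tail2 /tl; case: b; lia.
have hd_tl o k b : (k < t)%N -> (hd o)./2 <> tl k b.
  by move=> kt; have := hd_lt o; rewrite /tl; case: b; lia.
apply: (cross_gequiv (f := f)) => //.
- move=> [o|[[[|k] /= kt] b]] [o'|[[[|k'] /= kt'] b']] //=.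
  + move=> [/(congr1 (@nat_of_ord m))]; rewrite !hdE => h1 h2; congr inl; apply: hd_inj.
    by rewrite -[LHS]odd_double_half -[RHS]odd_double_half h1 h2.
  + by move=> [/(congr1 (@nat_of_ord m))]; rewrite hdE tlE // => /hd_tl; case.
  + by move=> [->]; congr (inr (_, _)); apply: val_inj.
  + by move=> [/(congr1 (@nat_of_ord m))]; rewrite hdE tlE // => /esym/hd_tl; case.
  + move=> [/(congr1 (@nat_of_ord m))]; rewrite !tlE // /tl => h.
    have -> : b = b' by move: h; case: b; case: b' => //; lia.
    by congr (inr (_, _)); apply: val_inj => /=; move: h; case: b; case: b'; lia.
- move=> [b _|[i b]]; first by exists (inr (ord0, b)).
  rewrite Sr; have [ih _|ih /=] := ltnP (2 * i + b) r'.+2.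
    suff [o oE] : exists o, hd o = (2 * i + b)%N.
      exists (inl o); rewrite /f; congr (inr (_, _)); last by rewrite oE;
        case: b {ih oE}; lia.
      by apply: ord_inj; rewrite hdE oE; case: b {ih oE}; lia.
    case: (2 * i + b)%N ih => [|k] ih; first by exists None.
    by exists (Some (@Ordinal r'.+1 k ih)).
  move=> /andP[Mi /negbTE ->]; have im := ltn_ord i.
  have kt : (((i - 2) %/ 2).+1 < t.+1)%N by lia.
  exists (inr (Ordinal kt, ((i - 2) %% 2 == 1)%N)); rewrite /f /=; congr (inr (_, _)).
  by apply: ord_inj; rewrite tlE // /tl; case: eqP => /=; lia.
- move=> [o|[[[|k] /= kt] b]] [o'|[[[|k'] /= kt'] b']] //=; rewrite ?ell //.
  + have := fS (inl o); have := fS (inl o'); rewrite /= => So' So;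
      rewrite er // !hdE' !hd_lt /=.
    rewrite -(inj_eq hd_inj) !hdE; have := hd_lt o; have := hd_lt o'; lia.
  + by rewrite sy elr.
  + have := fS (inl o); have := fS (inr (Ordinal kt', b')); rewrite /= => So' So.
    rewrite er // !hdE' hdE !tlE //; have := hd_lt o; rewrite /tl; case: b' {So'}; lia.
  + have := fS (inl o'); have := fS (inr (Ordinal kt, b)); rewrite /= => So So'.
    rewrite er // !hdE' hdE !tlE //; have := hd_lt o'; rewrite /tl; case: b {So}; lia.
  + by rewrite sy elr.
  + have := fS (inr (Ordinal kt, b)); have := fS (inr (Ordinal kt', b'));
      rewrite /= => So' So.
    rewrite er // -!val_eqE /= !tlE // !tail_tl; case: b {So}; case: b' {So'};
      rewrite /tl /=; lia.
Qed.

Let full_ladder ep t : m = (2 + 2 * t)%N ->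
  @gequiv R _ predT (ladder_adj m ep) (ladder_vertex 2) (ladder_adj 2 (ep (+) odd t)).
Proof.
move=> mE; apply: gequiv_trans (ladder_steps ep mE).
apply: eq_gequiv => //; try exact: ladder_adj_irr.
by move=> [b|[i b]] //=; rewrite ltn_ord.
Qed.

(** Two columns, the two rails and the crossed closing are the six edges of $K_4$. *)
Lemma ladder_cross_odd ep t : m = (2 + 2 * t)%N -> ep (+) odd t ->
  homotopy_equivalent R (flag R (ind predT (ladder_adj m ep))) (flag R (@cross 2 t.+1)).
Proof.
move=> mE et; apply: heq_trans (full_ladder ep mE) _; rewrite et.
apply: (ladder_reduced_cross (t := t)) => // [|i b|i b j c].
- exact: ladder_adj_sym.
- by rewrite /=; case: b => /=; lia.
- rewrite /= /ladder_half; case: b; case: c => /=;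
    rewrite /= ?(andbF, andbT, orbF, orbT) => Si Sj; apply/idP/idP => ?; lia.
Qed.

(** Without a twist the closing repeats the rails, and the two columns form a 4-cycle, which folds
    to an edge. *)
Lemma ladder_cross_even ep t : m = (2 + 2 * t)%N -> ~~ (ep (+) odd t) ->
  homotopy_equivalent R (flag R (ind predT (ladder_adj m ep))) (flag R (@cross 0 t.+1)).
Proof.
move=> mE /negbTE et; apply: heq_trans (full_ladder ep mE) _; rewrite et.
have [h0 h1] : (0 < m)%N /\ (1 < m)%N by lia.
pose o k h b : bool + 'I_m * bool := inr (@Ordinal m k h, b).
apply: (@heq_trans _ (flag R (ind [pred x | ladder_vertex 2 x && (x != o _ h1 true)]
    (ladder_adj 2 false)))).
  apply: (@remove_vertex _ _ _ _ _ (o _ h0 false)) => //.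
  - exact: ladder_adj_sym.
  - exact: ladder_adj_irr.
  - move=> [b|[i b]] //=; rewrite /ladder_half; case: b => /=; lia.
apply: (@heq_trans _ (flag R (ind [pred x | [pred x | ladder_vertex 2 x &&
    (x != o _ h1 true)] x && (x != o _ h1 false)] (ladder_adj 2 false)))).
  apply: (@remove_vertex _ _ _ _ _ (o _ h0 true)) => //.
  - exact: ladder_adj_sym.
  - exact: ladder_adj_irr.
  - move=> [b|[i b]] //=; rewrite /o !vertex_eqE /ladder_half /=; case: b => /=; lia.
apply: (ladder_reduced_cross (t := t)) => // [|i b|i b j c].
- exact: ladder_adj_sym.
- rewrite /= /o !vertex_eqE; case: b => /=; lia.
- rewrite /= /o !vertex_eqE /ladder_half; case: b; case: c => /=;
    rewrite /= ?(andbF, andbT, orbF, orbT) => Si Sj; apply/idP/idP => ?; lia.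
Qed.
End Ladders.

(** * The graphs E *)

Local Notation vidx n := 'Z_(n.*2.+2).

Section ExplicitGraphs.
Variable n : nat.

Lemma index_add1 (x : vidx n) :
  (x + 1 : vidx n) = (if x.+1 < n.*2.+2 then x.+1 else 0)%N :> nat.
Proof.
have xN : (x < n.*2.+2)%N := ltn_ord x.
rewrite /= modnDmr addn1; case: ifP => [h|/negbT]; first by rewrite modn_small.
by rewrite -leqNgt => h; rewrite (_ : x.+1 = n.*2.+2) ?modnn //; lia.
Qed.

Lemma index_addn (k : nat) (x : vidx n) : (k < n.*2.+2)%N ->
  (x + k%:R : vidx n) =
    (if x + k < n.*2.+2 then x + k else x + k - n.*2.+2)%N :> nat.
Proof.
move=> kN; have xN : (x < n.*2.+2)%N := ltn_ord x.
have kE : nat_of_ord (k%:R : vidx n) = k by rewrite val_Zp_nat // modn_small.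
rewrite /= kE; case: ifP => [h|/negbT]; first by rewrite modn_small.
rewrite -leqNgt => h; rewrite -{1}(subnK h) modnDr modn_small //; lia.
Qed.

Lemma Knn_adjE (i j : Knn n) : adj i j = (odd i != odd j).
Proof.
rewrite /adj /= /edge_of; have [->|_ /=] := eqVneq i j; first by rewrite eqxx.
by case: (odd i); case: (odd j).
Qed.

Lemma glue_adjE (G H : sgraph) (r : G -> H -> bool) (u v : Defs.glue r) :
  adj u v = match u : (G + H)%type, v : (G + H)%type with
            | inl x, inl y => adj x y
            | inr x, inr y => adj x y
            | inl x, inr y | inr y, inl x => r x y
            end.
Proof.
rewrite -[adj u v]/(edge_of (glued_rel r) u v) /edge_of /glued_rel;
  case: u v => [x|x] [y|y] //=.
- have -> : (inl x == inl y :> (G + H)%type) = (x == y) by [].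
  by have [->|_] := eqVneq x y; rewrite ?adj_irrefl // (adj_sym y) orbb.
- by rewrite orbF.
- have -> : (inr x == inr y :> (G + H)%type) = (x == y) by [].
  by have [->|_] := eqVneq x y; rewrite ?adj_irrefl // (adj_sym y) orbb.
Qed.

(** Column i is the chord from $c_i$ to $c_{i+n+1}$. Going on from $c_n$ to $c_{n+1}$ leads from row
    false of the last column to row true of the first, hence the twist. *)
Lemma DC_ladder (i j : 'I_n.+1) (b c : bool) (x y : DC n) : (1 < n)%N ->
  nat_of_ord (x : vidx n) = (i + n.+1 * b)%N ->
  nat_of_ord (y : vidx n) = (j + n.+1 * c)%N ->
  adj x y = ladder_half n.+1 n.+1 true i b j c || ladder_half n.+1 n.+1 true j c i b.
Proof.
move=> n1 xE yE; have := ltn_ord i; have := ltn_ord j.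
rewrite /adj /= /edge_of -!(inj_eq (@ord_inj _)).
rewrite (index_add1 x) (index_add1 y) !index_addn; try lia.
rewrite xE yE /ladder_half => jn im; case: b {xE}; case: c {yE};
  rewrite /= ?(muln0, muln1, addn0, andbF, andbT, orbF); do ?[case: ifP => ?];
  apply/idP/idP => ?; lia.
Qed.

Lemma Codd_cycle (i j : 'I_n.+1) (x y : Codd n) : (1 < n)%N ->
  nat_of_ord (val x) = (2 * i).+1 -> nat_of_ord (val y) = (2 * j).+1 ->
  adj x y = cycle_half n.+1 n.+1 i j || cycle_half n.+1 n.+1 j i.
Proof.
move=> n1 xE yE; have := ltn_ord i; have := ltn_ord j.
have e2 (u v : vidx n) : (u == v + 2%:R) =
    (u == (if v + 2 < n.*2.+2 then v + 2 else v + 2 - n.*2.+2) :> nat)%N.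
  by rewrite -(inj_eq (@ord_inj _)) index_addn //; lia.
rewrite -[adj x y]/((x != y) && ((val y == val x + 2%:R) || (val x == val y + 2%:R))).
rewrite -(inj_eq val_inj x y) -(inj_eq (@ord_inj _)) !e2 xE yE /cycle_half => jn im;
  do ?[case: ifP => ?]; apply/idP/idP => ?; lia.
Qed.
End ExplicitGraphs.

Lemma eq_flag (R : realType) (V : finType) (e e' : rel V) :
  (forall u v, e u v = e' u v) ->
  homotopy_equivalent R (flag R e) (flag R e').
Proof.
move=> ee; rewrite (_ : e = e'); first exact: heq_refl.
by apply/funext => u; apply/funext => v; exact: ee.
Qed.

Lemma Ind_E_odd (R : realType) (n : nat) : (3 <= n)%N -> odd n ->
  homotopy_equivalent R (realization R (Ind (E n)))
    (flag R (ind predT (@ladder_adj n.+1 n.+1 true))).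
Proof.
move=> n3 on; rewrite /E on realization_IndE.
pose A : finType := vidx n.
pose side : pred A := fun i : vidx n => odd i.
pose f : rel A := @adj (DC n).
pose r (x y : A) : bool := x == y.
pose o k (h : (k < n.*2.+2)%N) : vidx n := Ordinal h.
have h0 : (0 < n.*2.+2)%N by [].
have h1 : (1 < n.*2.+2)%N by lia.
have hn : (n.+1 < n.*2.+2)%N by lia.
have hn' : (n.+2 < n.*2.+2)%N by lia.
apply: (@heq_trans _ (flag R (fun u v => ~~ glued_adj side f r u v))).
  apply: eq_flag => u v; congr (~~ _); rewrite glue_adjE.
  by case: u v => [u|u] [v|v] //; rewrite Knn_adjE.
have chord (x y : vidx n) : (y = x + n.+1 :> nat)%N -> f x y.
  move=> xy; have yN : (y < n.*2.+2)%N := ltn_ord y.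
  rewrite /f -[adj _ _]/((x != y) && _) -!(inj_eq (@ord_inj _)) !index_addn //.
  by rewrite xy; case: ifP => [_|]; lia.
have rE (x : A) : r x =1 pred1 x by move=> y; rewrite /r /= eq_sym.
(* Since n + 1 is even, antipodal vertices lie on the same side: the pairs 1, n+2 and 0, n+1 are
   each attached to the ends of a chord. *)
have s1 : side (o _ h1) by [].
have s2 : side (o _ hn') by rewrite /side /= negbK.
have s3 : ~~ side (o _ h0) by [].
have s4 : ~~ side (o _ hn) by rewrite /side /= on.
have f1 : f (o _ h1) (o _ hn') by apply: chord => /=; lia.
have f2 : f (o _ h0) (o _ hn) by apply: chord => /=; lia.
apply: heq_trans (@glued_suspension R _ _ side f r (@adj_sym (DC n)) (@adj_irrefl (DC
  n))
  _ _ _ _ _ _ _ _ s1 s2 s3 s4 (rE _) (rE _) f1 (rE _) (rE _) f2) _.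
apply: heq_sym.
pose g (v : 'I_n.+1 * bool) : nat := (v.1 + n.+1 * v.2)%N.
have gN v : (g v < n.*2.+2)%N.
  by rewrite /g; case: v => i b; have := ltn_ord i; case: b => /=; lia.
pose phi (u : bool + 'I_n.+1 * bool) : bool + vidx n :=
  match u with inl b => inl b | inr v => inr (o _ (gN v)) end.
have phi_inj : injective phi.
  move=> [b|[i b]] [c|[j c]] //= [].
    by move=> ->.
  have := ltn_ord i; have := ltn_ord j; rewrite /g /= => jn im h.
  have bc : b = c by move: h; case: b; case: c => //=; lia.
  by rewrite bc; congr (inr (_, _)); apply: ord_inj; move: h; rewrite bc; lia.
apply: (heq_trans _ (flag_transfer (f := phi) phi_inj _)).
  apply: eq_flag => u v; rewrite /ind /=; congr (~~ _).
  case: u v => [b|[i b]] [c|[j c]] //=; apply/esym; apply: (DC_ladder _ _ _) => //; lia.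
move=> [b _|x _]; first by exists (inl b).
have xN : (x < n.*2.+2)%N := ltn_ord x.
have [xn|xn] := ltnP x n.+1.
  exists (inr (Ordinal xn, false)); congr inr; apply: ord_inj.
  by rewrite /= /g /= muln0 addn0.
have xn' : (x - n.+1 < n.+1)%N by lia.
exists (inr (Ordinal xn', true)); congr inr; apply: ord_inj.
by rewrite /= /g /=; lia.
Qed.

Lemma Ind_E_even (R : realType) (n : nat) : (3 <= n)%N -> ~~ odd n ->
  homotopy_equivalent R (realization R (Ind (E n)))
    (flag R (ind predT (@cycle_adj n.+1 n.+1))).
Proof.
move=> n3 on; rewrite /E (negbTE on) realization_IndE.
pose A : finType := vidx n.
pose H : finType := {i : vidx n | odd i}.
pose side : pred A := fun i : vidx n => odd i.
pose f : rel H := @adj (Codd n).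
pose r (x : A) (y : H) : bool := (x == val y) || (x == val y + n.+1%:R).
pose o k (h : (k < n.*2.+2)%N) : vidx n := Ordinal h.
have h1 : (1 < n.*2.+2)%N by lia.
have h3 : (3 < n.*2.+2)%N by lia.
have hn : (n.+2 < n.*2.+2)%N by lia.
have hn' : (n.+4 < n.*2.+2)%N by lia.
apply: (@heq_trans _ (flag R (fun u v => ~~ glued_adj side f r u v))).
  apply: eq_flag => u v; congr (~~ _); rewrite glue_adjE.
  by case: u v => [u|u] [v|v] //; rewrite Knn_adjE.
pose c k (h : (k < n.*2.+2)%N) (ok : odd k) : H := exist _ (o k h) ok.
have rE (x : vidx n) (y : H) : r x y = ((x == val y :> nat) ||
    (x == (if val y + n.+1 < n.*2.+2 then val y + n.+1 else val y + n.+1 - n.*2.+2) :>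
      nat)%N).
  by rewrite /r -!(inj_eq (@ord_inj _)) index_addn //; lia.
have yP (y : H) : odd (val y) /\ (val y < n.*2.+2)%N by split;
  [exact: (valP y)|exact: ltn_ord].
have cE (y : H) k h ok : (y == c k h ok) = (val y == k :> nat) by [].
have f13 : f (c 1 h1 isT) (c 3 h3 isT).
  have n1 : (1 < n.+1)%N by lia.
  rewrite /f (@Codd_cycle n ord0 (Ordinal n1)) //; last by lia.
  by rewrite /cycle_half /= n1.
(* For even n, adding n + 1 changes parity. As (n+2) + (n+1) is 1 modulo 2n+2, the even vertices n+2
   and n+4 are attached to $c_1$ and $c_3$, like the odd vertices 1 and 3. That n + 4 is in range
   uses [n3]. *)
have s1 : side (o _ h1) by [].
have s2 : side (o _ h3) by [].
have s3 : ~~ side (o _ hn) by rewrite /side /= negbK.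
have s4 : ~~ side (o _ hn') by rewrite /side /= !negbK.
have r1 : r (o _ h1) =1 pred1 (c 1 h1 isT).
  move=> y; rewrite rE /= cE; have [] := yP y.
  by move: (nat_of_ord (val y)) => k ok kn; case: ifP => ?; lia.
have r2 : r (o _ h3) =1 pred1 (c 3 h3 isT).
  move=> y; rewrite rE /= cE; have [] := yP y.
  by move: (nat_of_ord (val y)) => k ok kn; case: ifP => ?; lia.
have r3 : r (o _ hn) =1 pred1 (c 1 h1 isT).
  move=> y; rewrite rE /= cE; have [] := yP y.
  by move: (nat_of_ord (val y)) => k ok kn; case: ifP => ?; lia.
have r4 : r (o _ hn') =1 pred1 (c 3 h3 isT).
  move=> y; rewrite rE /= cE; have [] := yP y.
  by move: (nat_of_ord (val y)) => k ok kn; case: ifP => ?; lia.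
apply: heq_trans (@glued_suspension R _ _ side f r (@adj_sym (Codd n)) (@adj_irrefl
  (Codd n))
  _ _ _ _ _ _ _ _ s1 s2 s3 s4 r1 r2 f13 r3 r4 f13) _.
apply: heq_sym.
have gN (i : 'I_n.+1) : ((2 * i).+1 < n.*2.+2)%N by have := ltn_ord i; lia.
have gO (i : 'I_n.+1) : odd (2 * i).+1 by rewrite mul2n /= odd_double.
pose phi (u : bool + 'I_n.+1) : bool + H :=
  match u with inl b => inl b | inr i => inr (c _ (gN i) (gO i)) end.
have phi_inj : injective phi.
  move=> [b|i] [b'|j] //= []; first by move=> ->.
  by move=> h; congr inr; apply: ord_inj; lia.
apply: (heq_trans _ (flag_transfer (f := phi) phi_inj _)).
  apply: eq_flag => u v; rewrite /ind /=; congr (~~ _).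
  case: u v => [b|i] [b'|j] //=; apply/esym; apply: Codd_cycle => //; lia.
move=> [b _|x _]; first by exists (inl b).
have [ox xN] := yP x.
have xn : ((val x)./2 < n.+1)%N by lia.
exists (inr (Ordinal xn)); congr inr; apply: val_inj; apply: ord_inj.
by rewrite /=; move: (nat_of_ord (val x)) ox => k ok; lia.
Qed.

(** * Assembling the cases *)

Lemma cross_sphere (R : realType) d :
  homotopy_equivalent R (flag R (@cross 0 d)) (sphere R d).
Proof. exact: heq_trans (cross_wedge 0 d) (@wedge_set1_sphere R d). Qed.

Lemma cross_wedge_spheres (R : realType) r' d :
  homotopy_equivalent R (flag R (@cross r' d)) (wedge_spheres R r'.+1 d).
Proof. exact: heq_trans (cross_wedge r' d) (@wedge_set_spheres R d r'). Qed.

Local Close Scope ring_scope.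
Local Close Scope classical_set_scope.

Theorem theorem1p3 (R : realType) (n : nat) (hn : 3 <= n) :
  (odd n ->
    (forall k : nat, n = 4 * k + 1 ->
       homotopy_equivalent R (realization R (Ind (E n)))
         (wedge_spheres R 3 (2 * k + 1))) /\
    (forall k : nat, n = 4 * k + 3 ->
       homotopy_equivalent R (realization R (Ind (E n)))
         (sphere R (2 * k + 2)))) /\
  (~~ odd n ->
    [/\ forall k : nat, n = 6 * k ->
          homotopy_equivalent R (realization R (Ind (E n)))
            (sphere R (2 * k)),
        forall k : nat, n = 6 * k + 2 ->
          homotopy_equivalent R (realization R (Ind (E n)))
            (wedge_spheres R 2 (2 * k + 1))
      & forall k : nat, n = 6 * k + 4 ->
          homotopy_equivalent R (realization R (Ind (E n)))
            (sphere R (2 * k + 2))]).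
Proof.
split=> on; split=> k nk.
- apply: heq_trans (Ind_E_odd R hn on) _.
  (* An even number of ladder steps preserves the twist of [DC], so the core is $K_4$; in the next
     case an odd number removes it. *)
  have mE : n.+1 = 2 + 2 * (2 * k) by lia.
  rewrite addn1; apply: (heq_trans _ (cross_wedge_spheres R 2 (2 * k).+1)).
  by apply: ladder_cross_odd mE _; rewrite mul2n odd_double.
- apply: heq_trans (Ind_E_odd R hn on) _.
  have mE : n.+1 = 2 + 2 * (2 * k).+1 by lia.
  rewrite addn2; apply: (heq_trans _ (cross_sphere R (2 * k).+2)).
  by apply: ladder_cross_even mE _; rewrite /= mul2n odd_double.
- apply: heq_trans (Ind_E_even R hn on) _.
  (* Here k is positive because n is at least 3, so the predecessor is a genuine one. *)
  have mE : n.+1 = 4 + 3 * (2 * k).-1 by lia.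
  have -> : 2 * k = (2 * k).-1.+1 by lia.
  exact: heq_trans (cycle_cross4 mE) (cross_sphere R _).
- apply: heq_trans (Ind_E_even R hn on) _.
  have mE : n.+1 = 3 + 3 * (2 * k) by lia.
  rewrite addn1.
  exact: heq_trans (cycle_cross3 mE) (cross_wedge_spheres R 1 _).
- apply: heq_trans (Ind_E_even R hn on) _.
  have mE : n.+1 = 2 + 3 * (2 * k).+1 by lia.
  rewrite addn2.
  exact: heq_trans (cycle_cross2 mE) (cross_sphere R _).
Qed.
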